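(* Let $H$ be a separable Hilbert space, $T$ a compact operator on $H$, and $2\le p<\infty$. The following are equivalent: (a) $T\in S_p$; (b) $\{\|Te_n\|\}\in\ell^p$ for every orthonormal basis $\{e_n\}$ of $H$; (c) $\{\|Tf_n\|\}\in\ell^p$ for every frame $\{f_n\}$ of $H$. Moreover, $$\|T\|_p^p=\sup\sum_{n=1}^\infty\|Te_n\|^p=\sup\sum_{n=1}^\infty\|Tf_n\|^p,$$ where the first supremum is over all orthonormal bases $\{e_n\}$ of $H$ and the second over all frames $\{f_n\}$ with upper frame bound at most $1$.
   Context: A sequence $\{f_n\}$ in $H$ is a frame if there are constants $0<C_1\le C_2$ such that $C_1\|f\|^2\le\sum_n|\langle f,f_n\rangle|^2\le C_2\|f\|^2$ for all $f\in H$. The upper frame bound is the infimum of all admissible $C_2$. For a compact operator $T$, its singular values $\lambda_1\ge\lambda_2\ge\cdots$ are the positive eigenvalues of $(T^*T)^{1/2}$, repeated according to multiplicity. For $0<p<\infty$, $S_p$ is the set of compact $T$ with $\{\lambda_n\}\in\ell^p$, and $\|T\|_p=(\sum_n\lambda_n^p)^{1/p}$. *)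

(* Defs.v *)
From Stdlib Require Import Reals Lra Classical.
Open Scope R_scope.

Record Cx := mkC { Cre : R ; Cim : R }.
Definition C0 : Cx := mkC 0 0.
Definition C1 : Cx := mkC 1 0.
Definition Cadd (a b : Cx) : Cx := mkC (Cre a + Cre b) (Cim a + Cim b).
Definition Cmul (a b : Cx) : Cx :=
  mkC (Cre a * Cre b - Cim a * Cim b) (Cre a * Cim b + Cim a * Cre b).
Definition Cconj (a : Cx) : Cx := mkC (Cre a) (- Cim a).
Definition RtoC (r : R) : Cx := mkC r 0.
Definition Cnorm2 (a : Cx) : R := Cre a * Cre a + Cim a * Cim a.

Record Hilbert := {
  hV :> Type;
  vadd : hV -> hV -> hV;
  vzero : hV;
  vopp : hV -> hV;
  vscal : Cx -> hV -> hV;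
  inner : hV -> hV -> Cx;
  vadd_assoc : forall x y z, vadd x (vadd y z) = vadd (vadd x y) z;
  vadd_comm : forall x y, vadd x y = vadd y x;
  vadd_0 : forall x, vadd vzero x = x;
  vadd_opp : forall x, vadd x (vopp x) = vzero;
  vscal_1 : forall x, vscal C1 x = x;
  vscal_assoc : forall a b x, vscal a (vscal b x) = vscal (Cmul a b) x;
  vscal_addv : forall a x y, vscal a (vadd x y) = vadd (vscal a x) (vscal a y);
  vscal_adds : forall a b x, vscal (Cadd a b) x = vadd (vscal a x) (vscal b x);
  inner_add : forall x y z, inner (vadd x y) z = Cadd (inner x z) (inner y z);
  inner_scal : forall a x y, inner (vscal a x) y = Cmul a (inner x y);
  inner_conj : forall x y, inner y x = Cconj (inner x y);
  inner_pos : forall x, x <> vzero -> 0 < Cre (inner x x);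
  complete : forall u : nat -> hV,
    (forall eps, 0 < eps -> exists N, forall n m, (N <= n)%nat -> (N <= m)%nat ->
        sqrt (Cre (inner (vadd (u n) (vopp (u m))) (vadd (u n) (vopp (u m))))) < eps) ->
    exists y, forall eps, 0 < eps -> exists N, forall n, (N <= n)%nat ->
        sqrt (Cre (inner (vadd (u n) (vopp y)) (vadd (u n) (vopp y)))) < eps
}.

Arguments vadd {h}. Arguments vzero {h}. Arguments vopp {h}.
Arguments vscal {h}. Arguments inner {h}.

Section Ops.
Context {H : Hilbert}.

Definition vsub (x y : H) : H := vadd x (vopp y).
Definition vnorm (x : H) : R := sqrt (Cre (inner x x)).

Definition separable : Prop :=
  exists d : nat -> H, forall x eps, 0 < eps -> exists n, vnorm (vsub x (d n)) < eps.

Definition linear_op (T : H -> H) : Prop :=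
  (forall x y, T (vadd x y) = vadd (T x) (T y)) /\
  (forall a x, T (vscal a x) = vscal a (T x)).

Definition compact_op (T : H -> H) : Prop :=
  linear_op T /\
  forall x : nat -> H, (exists M, forall n, vnorm (x n) <= M) ->
    exists (phi : nat -> nat) (y : H),
      (forall k, (phi k < phi (Datatypes.S k))%nat) /\
      (forall eps, 0 < eps -> exists N, forall k, (N <= k)%nat ->
          vnorm (vsub (T (x (phi k))) y) < eps).

Definition is_adjoint (T A : H -> H) : Prop :=
  forall x y, inner (T x) y = inner x (A y).

Definition positive_op (S : H -> H) : Prop :=
  linear_op S /\ forall x, Cim (inner (S x) x) = 0 /\ 0 <= Cre (inner (S x) x).

Definition is_modulus (T S : H -> H) : Prop :=
  positive_op S /\ exists A, is_adjoint T A /\ forall x, S (S x) = A (T x).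

Fixpoint vsum (m : nat) (f : nat -> H) : H :=
  match m with O => vzero | Datatypes.S k => vadd (vsum k f) (f k) end.

Definition eigen_dim (S : H -> H) (mu : R) (m : nat) : Prop :=
  exists u : nat -> H,
    (forall i j, (i < m)%nat -> (j < m)%nat ->
        inner (u i) (u j) = if Nat.eqb i j then C1 else C0) /\
    (forall i, (i < m)%nat -> S (u i) = vscal (RtoC mu) (u i)) /\
    (forall x, S x = vscal (RtoC mu) x ->
        x = vsum m (fun i => vscal (inner x (u i)) (u i))).

(** s is the sequence of singular values of T: the positive eigenvalues of
    (T^*T)^{1/2}, in nonincreasing order, repeated according to multiplicity,
    followed by zeros if there are only finitely many. *)
Definition singular_values (T : H -> H) (s : nat -> R) : Prop :=
  exists M, is_modulus T M /\
    (forall n, 0 <= s n) /\ (forall n, s (Datatypes.S n) <= s n) /\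
    (forall mu, 0 < mu -> exists m k, eigen_dim M mu m /\
        forall n, s n = mu <-> (k <= n < k + m)%nat).

End Ops.

(** x^p for x >= 0, p > 0 (with 0^p = 0) *)
Definition rpow (x p : R) : R := if Rle_dec x 0 then 0 else Rpower x p.

Definition in_lp (a : nat -> R) (p : R) : Prop :=
  exists l, infinite_sum (fun n => rpow (a n) p) l.

Section Classes.
Context {H : Hilbert}.

Definition in_Sp (T : H -> H) (p : R) : Prop :=
  compact_op T /\ exists s, singular_values T s /\ in_lp s p.

Definition Sp_pnorm_pow (T : H -> H) (p v : R) : Prop :=
  exists s, singular_values T s /\ infinite_sum (fun n => rpow (s n) p) v.

(** orthonormal basis indexed by the (arbitrary) subset D of nat *)
Definition orthonormal_basis (D : nat -> bool) (e : nat -> H) : Prop :=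
  (forall n m, D n = true -> D m = true ->
      inner (e n) (e m) = if Nat.eqb n m then C1 else C0) /\
  (forall x, (forall n, D n = true -> inner x (e n) = C0) -> x = vzero).

Definition frame_sum (f : nat -> H) (x : H) (l : R) : Prop :=
  infinite_sum (fun n => Cnorm2 (inner x (f n))) l.

Definition frame_bounds (f : nat -> H) (c1 c2 : R) : Prop :=
  0 < c1 /\ c1 <= c2 /\
  forall x, exists l, frame_sum f x l /\
     c1 * Rsqr (vnorm x) <= l /\ l <= c2 * Rsqr (vnorm x).

Definition frame (f : nat -> H) : Prop := exists c1 c2, frame_bounds f c1 c2.

Definition is_glb (E : R -> Prop) (m : R) : Prop :=
  (forall x, E x -> m <= x) /\ (forall b, (forall x, E x -> b <= x) -> b <= m).

Definition upper_frame_bound (f : nat -> H) (B : R) : Prop :=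
  is_glb (fun c2 => exists c1, frame_bounds f c1 c2) B.

End Classes.

(* Main.v *)
From Stdlib Require Import Reals Lra Lia Classical ClassicalEpsilon.
Require Import Defs.
Open Scope R_scope.

(** A singular value decomposition of the compact operator [T] is built without
    its adjoint: the [n]-th right singular vector [u_n] maximizes [|T x|] on the
    unit ball of the orthogonal complement of [u_0, ..., u_(n-1)]. The
    decomposition yields the adjoint and the modulus of [T], so the maxima
    [s_n] are the singular values, and
    [|T x|^2 = sum_k s_k^2 |<x, u_k>|^2].

    If [f] has upper frame bound [C], then [sum_k |<f_n, u_k>|^2 <= |f_n|^2 <= C]
    and [sum_n |<f_n, u_k>|^2 <= C]; since [p/2 >= 1], Jensen's inequality gives
    [sum_n |T f_n|^p <= C^(p/2) sum_k s_k^p]. Orthonormal bases are frames of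
    bound [1], and equality is attained by a basis that extends the [u_k], because
    [T] vanishes on their orthogonal complement. *)

(** [in_Sp] only asserts that some modulus and some sequence of its eigenvalues exist, and this
    shapes much of the work. On the one hand an adjoint and a modulus must be produced as functions:
    both are defined by series in the [u_k], and identities between them are checked on the
    coefficients along the [u_k]. On the other hand the sequence hidden in [in_Sp] must be matched
    with the maxima [s_n]: the eigenspaces of any modulus are described through <T x, T h> alone, so
    multiplicities depend only on [T], and a nonincreasing sequence is determined by its
    multiplicities. Compactness does more than make the maxima attained: it forces [s_n] to tend to
    0, and this is why [T] vanishes off the span of the [u_k]. When [T] has finite rank the [u_k]
    are zero from some index on. *)

(** * Finite sums, limits and nonnegative series of reals *)

Section Sums.

Fixpoint rsum (n : nat) (f : nat -> R) : R :=
  match n with O => 0 | Datatypes.S k => rsum k f + f k end.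

Lemma rsum_ext n f g :
  (forall i, (i < n)%nat -> f i = g i) -> rsum n f = rsum n g.
Proof.
  induction n as [|n IH]; intros E; simpl; [reflexivity|].
  rewrite IH, E; auto.
Qed.

Lemma rsum_le n f g :
  (forall i, (i < n)%nat -> f i <= g i) -> rsum n f <= rsum n g.
Proof.
  induction n as [|n IH]; intros E; simpl; [lra|].
  assert (A := E n ltac:(lia)). assert (B := IH ltac:(auto)). lra.
Qed.

Lemma rsum_nonneg n f : (forall i, 0 <= f i) -> 0 <= rsum n f.
Proof.
  intros E; induction n as [|n IH]; simpl; [lra|]. specialize (E n); lra.
Qed.

Lemma rsum_plus n f g : rsum n (fun i => f i + g i) = rsum n f + rsum n g.
Proof. induction n as [|n IH]; simpl; [|rewrite IH]; ring. Qed.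

Lemma rsum_scal n c f : rsum n (fun i => c * f i) = c * rsum n f.
Proof. induction n as [|n IH]; simpl; [|rewrite IH]; ring. Qed.

Lemma rsum_const n c : rsum n (fun _ => c) = INR n * c.
Proof.
  induction n as [|n IH]; simpl rsum; [simpl; ring|].
  rewrite IH, S_INR; ring.
Qed.

Lemma rsum_exchange n m (f : nat -> nat -> R) :
  rsum n (fun i => rsum m (f i)) = rsum m (fun j => rsum n (fun i => f i j)).
Proof.
  induction n as [|n IH]; simpl.
  - induction m as [|m IHm]; simpl; [|rewrite <- IHm]; ring.
  - rewrite IH, rsum_plus; reflexivity.
Qed.

Lemma Un_cv_const c : Un_cv (fun _ => c) c.
Proof.
  intros e He; exists 0%nat; intros n _.
  unfold R_dist; rewrite Rminus_diag, Rabs_R0; exact He.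
Qed.

Lemma Un_cv_ext (u v : nat -> R) l :
  (forall n, u n = v n) -> Un_cv u l -> Un_cv v l.
Proof.
  intros E C e He; destruct (C e He) as [N HN]; exists N; intros n Hn.
  rewrite <- E; apply HN; exact Hn.
Qed.

Lemma Un_cv_lim_eq (u : nat -> R) l l' : l = l' -> Un_cv u l -> Un_cv u l'.
Proof. intros ->; auto. Qed.

Lemma Un_cv_shift (u : nat -> R) l :
  Un_cv u l <-> Un_cv (fun n => u (Datatypes.S n)) l.
Proof.
  split; intros C e He; destruct (C e He) as [N HN].
  - exists N; intros n Hn; apply HN; lia.
  - exists (Datatypes.S N); intros [|n] Hn; [lia|apply HN; lia].
Qed.

(** Shaped for Cauchy-Schwarz: with [v n] = |x_n - y|^2 and [K] = |z|^2 it carries norm convergence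
    over to inner products. *)
Lemma Un_cv_sqr_le (u v : nat -> R) l K :
  (forall n, Rsqr (u n - l) <= v n * K) -> Un_cv v 0 -> Un_cv u l.
Proof.
  intros B C e He.
  assert (HK : 0 < Rabs K + 1) by (pose proof (Rabs_pos K); lra).
  destruct (C (e * e / (Rabs K + 1))) as [N HN].
  { apply Rdiv_lt_0_compat; nra. }
  exists N; intros n Hn; specialize (HN n Hn); specialize (B n).
  unfold R_dist in *; rewrite Rminus_0_r in HN.
  assert (Rabs (v n) * (Rabs K + 1) < e * e).
  { apply (Rmult_lt_compat_r _ _ _ HK) in HN.
    replace (e * e / (Rabs K + 1) * (Rabs K + 1)) with (e * e) in HN by (field; lra).
    exact HN. }
  assert (v n * K <= Rabs (v n) * Rabs K).
  { rewrite <- Rabs_mult; apply Rle_abs. }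
  pose proof (Rabs_pos (v n)).
  assert (D : Rsqr (u n - l) < Rsqr e) by (unfold Rsqr at 2; nra).
  apply Rsqr_lt_abs_0 in D. rewrite (Rabs_right e) in D by lra; exact D.
Qed.

Lemma Un_cv_squeeze0 (u v : nat -> R) :
  (forall n, 0 <= u n <= v n) -> Un_cv v 0 -> Un_cv u 0.
Proof.
  intros B C e He; destruct (C e He) as [N HN]; exists N; intros n Hn.
  specialize (HN n Hn); specialize (B n); unfold R_dist in *.
  rewrite Rminus_0_r in *. rewrite Rabs_right in * by lra. lra.
Qed.

Lemma Un_cv_rsum N (F : nat -> nat -> R) (L : nat -> R) :
  (forall i, (i < N)%nat -> Un_cv (F i) (L i)) ->
  Un_cv (fun K => rsum N (fun i => F i K)) (rsum N L).
Proof.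
  induction N as [|N IH]; intros C; simpl; [apply Un_cv_const|].
  apply CV_plus; [apply IH|apply C]; auto.
Qed.

Lemma Un_cv_le_const (u : nat -> R) l c :
  Un_cv u l -> (forall n, u n <= c) -> l <= c.
Proof. intros C B; exact (Rle_cv_lim B C (Un_cv_const c)). Qed.

Lemma infinite_sum_rsum f l : infinite_sum f l <-> Un_cv (fun n => rsum n f) l.
Proof.
  (* [sum_f_R0 f n] contains the term of index n, hence the shift by one. *)
  assert (E : forall n, sum_f_R0 f n = rsum (Datatypes.S n) f).
  { induction n as [|n IH]; simpl; [ring|rewrite IH; reflexivity]. }
  rewrite Un_cv_shift; split; intros C e He; destruct (C e He) as [N HN];
    exists N; intros n Hn; specialize (HN n Hn); rewrite E in *; exact HN.
Qed.

Lemma rsum_le_infinite_sum f l n :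
  (forall i, 0 <= f i) -> infinite_sum f l -> rsum n f <= l.
Proof.
  intros P C; apply infinite_sum_rsum in C.
  apply (growing_ineq (fun n => rsum n f)); [|exact C].
  intros k; simpl; specialize (P k); lra.
Qed.

Lemma bounded_rsum_cv f b :
  (forall i, 0 <= f i) -> (forall n, rsum n f <= b) ->
  exists l, Un_cv (fun n => rsum n f) l /\ l <= b.
Proof.
  intros P B.
  destruct (growing_cv (fun n => rsum n f)) as [l C].
  - intros k; simpl; specialize (P k); lra.
  - exists b; intros x [n ->]; apply B.
  - exists l; split; [exact C|]. apply (Un_cv_le_const _ _ _ C B).
Qed.

Lemma bounded_rsum_summable f b :
  (forall i, 0 <= f i) -> (forall n, rsum n f <= b) ->
  exists l, infinite_sum f l /\ l <= b.
Proof.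
  intros P B; destruct (bounded_rsum_cv f b P B) as [l [C D]].
  exists l; split; [apply infinite_sum_rsum|]; assumption.
Qed.

Lemma infinite_sum_ext f g l :
  (forall n, f n = g n) -> infinite_sum f l -> infinite_sum g l.
Proof.
  intros E; rewrite !infinite_sum_rsum; apply Un_cv_ext.
  intros n; apply rsum_ext; auto.
Qed.

End Sums.

(** * Complex scalars and the algebra of the inner product *)

Definition Copp (a : Cx) : Cx := mkC (- Cre a) (- Cim a).
Definition Ci : Cx := mkC 0 1.

Lemma Cx_ext (a b : Cx) : Cre a = Cre b -> Cim a = Cim b -> a = b.
Proof. destruct a, b; simpl; intros -> ->; reflexivity. Qed.

Ltac cring := apply Cx_ext; simpl; ring.

Section Basics.
Context {H : Hilbert}.
Implicit Types x y z h : H.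

Definition nsq x : R := Cre (inner x x).

Lemma vadd_0_r x : vadd x vzero = x.
Proof. rewrite vadd_comm; apply vadd_0. Qed.

Lemma inner_0_l y : inner vzero y = C0.
Proof.
  pose proof (inner_add H vzero vzero y) as E; rewrite vadd_0 in E.
  apply (f_equal Cre) in E as E1; apply (f_equal Cim) in E as E2; simpl in *.
  apply Cx_ext; simpl; lra.
Qed.

Lemma inner_opp_l x y : inner (vopp x) y = Copp (inner x y).
Proof.
  pose proof (inner_add H x (vopp x) y) as E; rewrite vadd_opp, inner_0_l in E.
  apply (f_equal Cre) in E as E1; apply (f_equal Cim) in E as E2; simpl in *.
  apply Cx_ext; simpl; lra.
Qed.

Lemma inner_add_r x y z : inner x (vadd y z) = Cadd (inner x y) (inner x z).
Proof.
  rewrite inner_conj, inner_add, (inner_conj H y x), (inner_conj H z x).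
  destruct (inner x y), (inner x z); cring.
Qed.

Lemma inner_scal_r a x y : inner x (vscal a y) = Cmul (Cconj a) (inner x y).
Proof.
  rewrite inner_conj, inner_scal, (inner_conj H y x).
  cring.
Qed.

Lemma inner_0_r x : inner x vzero = C0.
Proof. rewrite inner_conj, inner_0_l; cring. Qed.

Lemma inner_opp_r x y : inner x (vopp y) = Copp (inner x y).
Proof. rewrite inner_conj, inner_opp_l, (inner_conj H y x); cring. Qed.

Lemma inner_sub_l x y z : inner (vsub x y) z = Cadd (inner x z) (Copp (inner y z)).
Proof. unfold vsub; rewrite inner_add, inner_opp_l; reflexivity. Qed.

Lemma inner_sub_r x y z : inner z (vsub x y) = Cadd (inner z x) (Copp (inner z y)).
Proof. unfold vsub; rewrite inner_add_r, inner_opp_r; reflexivity. Qed.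

Lemma inner_re_sym x y : Cre (inner y x) = Cre (inner x y).
Proof. rewrite inner_conj; reflexivity. Qed.

Lemma inner_im_sym x y : Cim (inner y x) = - Cim (inner x y).
Proof. rewrite inner_conj; reflexivity. Qed.

Lemma inner_im_self x : Cim (inner x x) = 0.
Proof. pose proof (inner_im_sym x x); lra. Qed.

Lemma inner_self x : inner x x = RtoC (nsq x).
Proof. apply Cx_ext; [reflexivity|apply inner_im_self]. Qed.

Lemma inner_0_sym x y : inner x y = C0 -> inner y x = C0.
Proof. intros E; rewrite inner_conj, E; cring. Qed.

Lemma nsq_nonneg x : 0 <= nsq x.
Proof.
  unfold nsq; destruct (classic (x = vzero)) as [->|N].
  - rewrite inner_0_l; simpl; lra.
  - left; apply inner_pos, N.
Qed.

Lemma nsq_0_eq x : nsq x <= 0 -> x = vzero.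
Proof.
  intros Z; apply NNPP; intros N; apply inner_pos in N; unfold nsq in Z; lra.
Qed.

Lemma nsq_zero : nsq (@vzero H) = 0.
Proof. unfold nsq; rewrite inner_0_l; reflexivity. Qed.

Lemma vsub_0_eq x y : vsub x y = vzero -> x = y.
Proof.
  unfold vsub; intros E.
  rewrite <- (vadd_0_r x), <- (vadd_opp H y), (vadd_comm H y), vadd_assoc, E.
  apply vadd_0.
Qed.

Lemma inner_ext x y : (forall z, inner x z = inner y z) -> x = y.
Proof.
  intros E; apply vsub_0_eq, nsq_0_eq; unfold nsq.
  rewrite inner_sub_l, E; simpl; lra.
Qed.

End Basics.

Ltac inner_expand :=
  repeat (rewrite ?inner_add, ?inner_add_r, ?inner_sub_l, ?inner_sub_r,
    ?inner_scal, ?inner_scal_r, ?inner_opp_l, ?inner_opp_r, ?inner_0_l, ?inner_0_r).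

(* Two vectors with the same inner products against everything are equal, so
   vector identities reduce to ring identities between inner products. *)
Ltac vring := apply inner_ext; intro; inner_expand; cring.

(** * Norms, limits, closed subspaces and orthogonal projection *)

Section Norms.
Context {H : Hilbert}.
Implicit Types x y z h : H.

Lemma nsq_add x y : nsq (vadd x y) = nsq x + nsq y + 2 * Cre (inner x y).
Proof.
  unfold nsq; inner_expand; simpl; rewrite (inner_re_sym x y); ring.
Qed.

Lemma nsq_sub x y : nsq (vsub x y) = nsq x + nsq y - 2 * Cre (inner x y).
Proof.
  unfold nsq; inner_expand; simpl; rewrite (inner_re_sym x y); ring.
Qed.

Lemma nsq_scal a x : nsq (vscal a x) = Cnorm2 a * nsq x.
Proof.
  unfold nsq, Cnorm2; inner_expand; simpl; rewrite inner_im_self; ring.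
Qed.

Lemma nsq_sub_sym x y : nsq (vsub x y) = nsq (vsub y x).
Proof. rewrite !nsq_sub, (inner_re_sym x y); ring. Qed.

Lemma nsq_sub_triangle x y z :
  nsq (vsub x z) <= 2 * nsq (vsub x y) + 2 * nsq (vsub y z).
Proof.
  replace (vsub x z) with (vadd (vsub x y) (vsub y z)) by vring.
  rewrite nsq_add.
  pose proof (nsq_nonneg (vsub (vsub x y) (vsub y z))) as P.
  rewrite (nsq_sub (vsub x y)) in P; lra.
Qed.

Lemma nonneg_quadratic a b c :
  0 <= a -> (forall t, 0 <= a * t * t + 2 * b * t + c) -> b * b <= a * c.
Proof.
  intros A Q; destruct A as [A|<-].
  - specialize (Q (- b / a)).
    replace (a * (- b / a) * (- b / a) + 2 * b * (- b / a) + c)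
      with ((a * c - b * b) / a) in Q by (field; lra).
    apply (Rmult_le_compat_r a) in Q; [|lra].
    replace ((a * c - b * b) / a * a) with (a * c - b * b) in Q by (field; lra).
    lra.
  - destruct (Req_dec b 0) as [->|B]; [lra|].
    (* With a = 0 and b nonzero the polynomial is affine, and it takes the value -1 at this
       point. *)
    specialize (Q (- (c + 1) / (2 * b))).
    replace (0 * (- (c + 1) / (2 * b)) * (- (c + 1) / (2 * b))
             + 2 * b * (- (c + 1) / (2 * b)) + c) with (-1) in Q by (field; lra).
    lra.
Qed.

Lemma cauchy_schwarz_re x y :
  Cre (inner x y) * Cre (inner x y) <= nsq x * nsq y.
Proof.
  apply nonneg_quadratic; [apply nsq_nonneg|intros t].
  pose proof (nsq_nonneg (vadd (vscal (RtoC t) x) y)) as P.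
  rewrite nsq_add, nsq_scal in P; unfold Cnorm2 in P; inner_expand.
  rewrite inner_scal in P; simpl in P; lra.
Qed.

(** Reduces imaginary parts to real ones, so that limits and first-order conditions are proved for
    real parts only. *)
Lemma Cim_inner x y : Cim (inner x y) = Cre (inner x (vscal Ci y)).
Proof. rewrite inner_scal_r; simpl; ring. Qed.

Lemma vnorm_nsq x : Rsqr (vnorm x) = nsq x.
Proof. apply Rsqr_sqrt, nsq_nonneg. Qed.

Lemma vnorm_nonneg x : 0 <= vnorm x.
Proof. apply sqrt_pos. Qed.

Lemma vnorm_lt x e : 0 < e -> (vnorm x < e <-> nsq x < e * e).
Proof.
  intros He; pose proof (vnorm_nonneg x); rewrite <- vnorm_nsq; unfold Rsqr.
  split; intros; nra.
Qed.

Lemma vnorm_le x e : 0 <= e -> nsq x <= e * e -> vnorm x <= e.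
Proof.
  intros He; pose proof (vnorm_nonneg x); rewrite <- vnorm_nsq; unfold Rsqr.
  intros; nra.
Qed.

Definition vconv (v : nat -> H) (y : H) : Prop := Un_cv (fun n => nsq (vsub (v n) y)) 0.

Lemma Un_cv_0_pos (u : nat -> R) : (forall n, 0 <= u n) ->
  (Un_cv u 0 <-> forall e, 0 < e -> exists N, forall n, (N <= n)%nat -> u n < e).
Proof.
  intros P; split; intros C e He; destruct (C e He) as [N HN]; exists N;
    intros n Hn; specialize (HN n Hn); unfold R_dist in *; rewrite Rminus_0_r in *;
    rewrite Rabs_right in * by (apply Rle_ge, P); exact HN.
Qed.

Lemma vconv_vnorm (v : nat -> H) y :
  vconv v y <-> forall e, 0 < e -> exists N, forall n, (N <= n)%nat ->
    vnorm (vsub (v n) y) < e.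
Proof.
  unfold vconv; rewrite Un_cv_0_pos by (intros; apply nsq_nonneg).
  split; intros C e He.
  - destruct (C (e * e)) as [N HN]; [nra|]. exists N; intros n Hn.
    apply vnorm_lt; auto.
  - destruct (C (sqrt e)) as [N HN]; [apply sqrt_lt_R0, He|]. exists N; intros n Hn.
    specialize (HN n Hn); apply vnorm_lt in HN; [|apply sqrt_lt_R0, He].
    rewrite sqrt_def in HN; lra.
Qed.

Lemma cauchy_vconv (v : nat -> H) :
  (forall e, 0 < e -> exists N, forall n m, (N <= n)%nat -> (N <= m)%nat ->
     nsq (vsub (v n) (v m)) < e) ->
  exists y, vconv v y.
Proof.
  intros C; destruct (complete H v) as [y Y].
  - intros e He; destruct (C (e * e)) as [N HN]; [nra|].
    exists N; intros n m Hn Hm; apply (vnorm_lt (vsub (v n) (v m))); auto.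
  - exists y; apply vconv_vnorm; exact Y.
Qed.

Lemma vconv_inner_re (v : nat -> H) y z :
  vconv v y -> Un_cv (fun n => Cre (inner (v n) z)) (Cre (inner y z)).
Proof.
  intros C; apply Un_cv_sqr_le with (fun n => nsq (vsub (v n) y)) (nsq z); [|exact C].
  intros n; pose proof (cauchy_schwarz_re (vsub (v n) y) z) as B.
  rewrite inner_sub_l in B; simpl in B; unfold Rsqr; lra.
Qed.

Lemma vconv_inner_im (v : nat -> H) y z :
  vconv v y -> Un_cv (fun n => Cim (inner (v n) z)) (Cim (inner y z)).
Proof.
  intros C; rewrite Cim_inner; eapply Un_cv_ext; [|apply vconv_inner_re, C].
  intros n; simpl; rewrite <- Cim_inner; reflexivity.
Qed.

(** Partial sums of an orthogonal series have a constant inner product with the k-th vector once n >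
    k; this passes the constant to the limit. *)
Lemma vconv_inner_eventually (v : nat -> H) y z c :
  vconv v y -> (exists N, forall n, (N <= n)%nat -> inner (v n) z = c) ->
  inner y z = c.
Proof.
  intros C [N E]; apply Cx_ext.
  - apply (UL_sequence (fun n => Cre (inner (v n) z))); [apply vconv_inner_re, C|].
    intros e He; exists N; intros n Hn.
    rewrite E by auto; unfold R_dist; rewrite Rminus_diag, Rabs_R0; exact He.
  - apply (UL_sequence (fun n => Cim (inner (v n) z))); [apply vconv_inner_im, C|].
    intros e He; exists N; intros n Hn.
    rewrite E by auto; unfold R_dist; rewrite Rminus_diag, Rabs_R0; exact He.
Qed.

Lemma vconv_nsq (v : nat -> H) y :
  vconv v y -> Un_cv (fun n => nsq (v n)) (nsq y).
Proof.
  intros C.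
  apply Un_cv_ext with
    (fun n => nsq (vsub (v n) y) + (2 * Cre (inner (v n) y) - nsq y)).
  { intros n; rewrite nsq_sub; ring. }
  apply Un_cv_lim_eq with (0 + (2 * Cre (inner y y) - nsq y)); [unfold nsq; ring|].
  apply CV_plus; [exact C|].
  apply CV_minus; [|apply Un_cv_const].
  apply CV_mult; [apply Un_cv_const|apply vconv_inner_re, C].
Qed.

Record closed_subspace (V : H -> Prop) : Prop := {
  csub_add : forall x y, V x -> V y -> V (vadd x y);
  csub_scal : forall a x, V x -> V (vscal a x);
  csub_lim : forall v y, (forall n, V (v n)) -> vconv v y -> V y;
  csub_0 : V vzero }.

Lemma csub_sub V x y : closed_subspace V -> V x -> V y -> V (vsub x y).
Proof.
  intros C X Y; replace (vsub x y) with (vadd x (vscal (RtoC (-1)) y)) by vring.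
  apply csub_add; auto; apply csub_scal; auto.
Qed.

Definition orth (S : H -> Prop) (x : H) : Prop := forall y, S y -> inner x y = C0.

Lemma orth_closed S : closed_subspace (orth S).
Proof.
  split.
  - intros x y X Y z Z; rewrite inner_add, X, Y by auto; cring.
  - intros a x X z Z; rewrite inner_scal, X by auto; cring.
  - intros v y V C z Z; apply (vconv_inner_eventually v y z C0 C).
    exists 0%nat; intros n _; apply V, Z.
  - intros z _; apply inner_0_l.
Qed.

(** The first-order condition at an extremum, used both for the nearest point of a subspace and for
    a maximizer of |T x|. *)
Lemma stationary_linear b c : (forall t, 0 <= 2 * b * t + c * t * t) -> b = 0.
Proof.
  intros Q.
  assert (C : 0 <= c).
  { pose proof (Q 1); pose proof (Q (-1)); lra. }
  assert (b * b <= c * 0) by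
    (apply nonneg_quadratic; [exact C|intros t; specialize (Q t); lra]).
  nra.
Qed.

Lemma inv_INR_cv : Un_cv (fun n => / INR (Datatypes.S n)) 0.
Proof.
  apply Un_cv_0_pos; [intros; left; apply Rinv_0_lt_compat, lt_0_INR; lia|].
  intros e He; destruct (archimed_cor1 e He) as [N [HN P]].
  exists N; intros n Hn; eapply Rle_lt_trans; [|exact HN].
  apply Rinv_le_contravar; [apply lt_0_INR, P|apply le_INR; lia].
Qed.

(** A minimizing sequence for the distance is Cauchy by the parallelogram law; orthogonality is the
    first-order condition at its limit. *)
Lemma projection_exists V x : closed_subspace V ->
  exists y, V y /\ forall z, V z -> inner (vsub x y) z = C0.
Proof.
  intros C.
  (* The infimum of the squared distances is taken as minus the supremum of their negatives, so it
     is [- d]. *)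
  set (E := fun r => exists z, V z /\ r = - nsq (vsub x z)).
  destruct (completeness E) as [d [UB LUB]].
  { exists 0; intros r [z [_ ->]]; pose proof (nsq_nonneg (vsub x z)); lra. }
  { exists (- nsq (vsub x vzero)), vzero; split; [apply (csub_0 _ C)|reflexivity]. }
  assert (LB : forall z, V z -> - d <= nsq (vsub x z)).
  { intros z Vz; assert (- nsq (vsub x z) <= d) by (apply UB; exists z; auto); lra. }
  assert (AP : forall n : nat, exists z, V z /\ nsq (vsub x z) < - d + / INR (Datatypes.S n)).
  { intros n; apply NNPP; intros N.
    assert (P : 0 < / INR (Datatypes.S n)) by (apply Rinv_0_lt_compat, lt_0_INR; lia).
    assert (d <= d - / INR (Datatypes.S n)); [|lra].
    apply LUB; intros r [z [Vz ->]].
    apply Rnot_lt_le; intros L; apply N; exists z; split; [exact Vz|lra]. }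
  destruct (choice _ AP) as [v Hv].
  destruct (cauchy_vconv v) as [y Y].
  { intros e He; destruct (archimed_cor1 (e / 4)) as [N [HN P]]; [lra|].
    exists N; intros n m Hn Hm.
    assert (B : forall k, (N <= k)%nat -> nsq (vsub x (v k)) < - d + e / 4).
    { intros k Hk; destruct (Hv k) as [_ L].
      assert (/ INR (Datatypes.S k) <= / INR N); [|lra].
      apply Rinv_le_contravar; [apply lt_0_INR, P|apply le_INR; lia]. }
    assert (A1 := B n Hn); assert (A2 := B m Hm).
    assert (A3 := LB (vscal (RtoC (1/2)) (vadd (v n) (v m)))
      ltac:(apply csub_scal, csub_add; auto; apply Hv)).
    (* The midpoint lies in [V], so its squared distance is at least [- d]; the two bounds with e /
       4 then leave less than e. *)
    assert (PL : nsq (vsub (v n) (v m)) = 2 * nsq (vsub x (v n)) + 2 * nsq (vsub x (v m))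
       - 4 * nsq (vsub x (vscal (RtoC (1/2)) (vadd (v n) (v m))))).
    { rewrite !nsq_sub, nsq_scal, nsq_add; inner_expand; unfold Cnorm2; simpl; field. }
    lra. }
  assert (Vy : V y) by (apply (csub_lim _ C v); [intros; apply Hv|exact Y]).
  assert (D : nsq (vsub x y) <= - d).
  { assert (C1 : Un_cv (fun n => nsq (vsub x (v n))) (nsq (vsub x y))).
    { apply vconv_nsq; unfold vconv.
      eapply Un_cv_ext; [|exact Y]; intros n; simpl.
      rewrite nsq_sub_sym; f_equal; vring. }
    assert (C2 : Un_cv (fun n => - d + / INR (Datatypes.S n)) (- d + 0)).
    { apply CV_plus; [apply Un_cv_const|apply inv_INR_cv]. }
    rewrite Rplus_0_r in C2; refine (Rle_cv_lim _ C1 C2).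
    intros n; left; apply Hv. }
  exists y; split; [exact Vy|].
  assert (RE : forall z, V z -> Cre (inner (vsub x y) z) = 0).
  { intros z Vz; apply stationary_linear with (nsq z); intros t.
    assert (A := LB (vsub y (vscal (RtoC t) z)) ltac:(apply csub_sub; auto; apply csub_scal; auto)).
    replace (vsub x (vsub y (vscal (RtoC t) z)))
      with (vadd (vsub x y) (vscal (RtoC t) z)) in A by vring.
    rewrite nsq_add, nsq_scal, inner_scal_r in A; unfold Cnorm2 in A; simpl in *; lra. }
  intros z Vz; apply Cx_ext; [apply RE, Vz|].
  rewrite Cim_inner; apply RE, csub_scal; auto.
Qed.

End Norms.

(** * Boundedness of a compact operator and maximizers of |T x| on closed subspaces *)

Section Compact.
Context {H : Hilbert} (T : H -> H).
Implicit Types x y z h : H.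

Lemma linear_0 : linear_op T -> T vzero = vzero.
Proof.
  intros [_ L]; replace (@vzero H) with (vscal C0 (@vzero H)) at 1 by vring.
  rewrite L; vring.
Qed.

Lemma linear_sub x y : linear_op T -> T (vsub x y) = vsub (T x) (T y).
Proof.
  intros [A L]; replace (vsub x y) with (vadd x (vscal (RtoC (-1)) y)) by vring.
  rewrite A, L; vring.
Qed.

Lemma compact_subseq (x : nat -> H) M : compact_op T ->
  (forall n, nsq (x n) <= M) ->
  exists (phi : nat -> nat) y,
    (forall k, (phi k < phi (Datatypes.S k))%nat) /\ vconv (fun k => T (x (phi k))) y.
Proof.
  intros [_ C] B; destruct (C x) as [phi [y [P Y]]].
  - exists (sqrt M); intros n; apply sqrt_le_1_alt, B.
  - exists phi, y; split; [exact P|apply vconv_vnorm, Y].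
Qed.

Lemma strict_mono_ge (phi : nat -> nat) :
  (forall k, (phi k < phi (Datatypes.S k))%nat) -> forall k, (k <= phi k)%nat.
Proof. intros P; induction k as [|k IH]; [lia|specialize (P k); lia]. Qed.

Lemma vconv_bounded (v : nat -> H) y :
  vconv v y -> exists N, forall n, (N <= n)%nat -> nsq (v n) < nsq y + 1.
Proof.
  intros C; destruct (vconv_nsq v y C 1 Rlt_0_1) as [N HN].
  exists N; intros n Hn; specialize (HN n Hn); unfold R_dist in HN.
  apply Rabs_def2 in HN; lra.
Qed.

Lemma vconv_cauchy (v : nat -> H) y :
  vconv v y -> forall e, 0 < e -> exists N, forall n m, (N <= n)%nat -> (N <= m)%nat ->
    nsq (vsub (v n) (v m)) < e.
Proof.
  intros C e He; unfold vconv in C.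
  rewrite Un_cv_0_pos in C by (intros; apply nsq_nonneg).
  destruct (C (e / 4)) as [N HN]; [lra|].
  exists N; intros n m Hn Hm.
  assert (A := HN n Hn); assert (B := HN m Hm).
  pose proof (nsq_sub_triangle (v n) y (v m)) as D.
  rewrite (nsq_sub_sym y) in D; lra.
Qed.

(** If |T x_n|^2 > n on the unit ball, a subsequence of the T x_n would converge and hence be
    bounded, against the growing indices. *)
Lemma compact_bounded_ball : compact_op T ->
  exists L, forall x, nsq x <= 1 -> nsq (T x) <= L.
Proof.
  intros C; apply NNPP; intros N.
  assert (A : forall n : nat, exists x, nsq x <= 1 /\ INR n < nsq (T x)).
  { intros n; apply NNPP; intros M; apply N; exists (INR n); intros x X.
    apply Rnot_lt_le; intros L; apply M; exists x; auto. }
  destruct (choice _ A) as [x X].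
  destruct (compact_subseq x 1 C) as [phi [y [P Y]]]; [intros; apply X|].
  destruct (vconv_bounded _ _ Y) as [K HK].
  destruct (INR_unbounded (nsq y + 1)) as [n Hn].
  set (k := Nat.max K n).
  assert (B := HK k ltac:(lia)); destruct (X (phi k)) as [_ D].
  assert (INR n <= INR (phi k)).
  { apply le_INR; pose proof (strict_mono_ge phi P k); lia. }
  lra.
Qed.

Lemma scale_to_unit x : x <> vzero ->
  exists r, 0 < r /\ r * r = nsq x /\ nsq (vscal (RtoC (/ r)) x) = 1.
Proof.
  intros N; assert (P : 0 < nsq x) by (apply inner_pos, N).
  exists (sqrt (nsq x)); assert (S := sqrt_lt_R0 _ P).
  assert (E := sqrt_def (nsq x) ltac:(lra)).
  repeat split; auto; rewrite nsq_scal; unfold Cnorm2; simpl.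
  rewrite <- E at 3; field; lra.
Qed.

Lemma nsq_linear_le (V : H -> Prop) L : linear_op T ->
  (forall a x, V x -> V (vscal a x)) ->
  (forall x, V x -> nsq x <= 1 -> nsq (T x) <= L) ->
  forall x, V x -> nsq (T x) <= L * nsq x.
Proof.
  intros [A S] VS B x Vx; destruct (classic (x = vzero)) as [->|N].
  { rewrite linear_0 by (split; auto); rewrite nsq_zero; lra. }
  destruct (scale_to_unit x N) as [r [P [E U]]].
  assert (D := B _ (VS (RtoC (/ r)) x Vx) ltac:(lra)).
  rewrite S, nsq_scal in D; unfold Cnorm2 in D; simpl in D.
  apply (Rmult_le_compat_r (r * r)) in D; [|nra].
  replace ((/ r * / r + 0 * 0) * nsq (T x) * (r * r)) with (nsq (T x)) in D
    by (field; lra).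
  rewrite E in D; exact D.
Qed.

Lemma compact_bounded : compact_op T ->
  exists L, 0 <= L /\ forall x, nsq (T x) <= L * nsq x.
Proof.
  intros C; destruct (compact_bounded_ball C) as [L B].
  assert (L0 : 0 <= L).
  { apply Rle_trans with (nsq (T vzero)); [apply nsq_nonneg|apply B; rewrite nsq_zero; lra]. }
  exists L; split; [exact L0|]; intros x.
  apply (nsq_linear_le (fun _ => True)); auto; apply C.
Qed.

Lemma bounded_vconv L (v : nat -> H) y : linear_op T ->
  (forall x, nsq (T x) <= L * nsq x) -> vconv v y -> vconv (fun n => T (v n)) (T y).
Proof.
  intros LT B C; unfold vconv.
  apply Un_cv_squeeze0 with (fun n => L * nsq (vsub (v n) y)).
  { intros n; split; [apply nsq_nonneg|rewrite <- linear_sub by auto; apply B]. }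
  apply Un_cv_lim_eq with (L * 0); [ring|].
  apply CV_mult; [apply Un_cv_const|exact C].
Qed.

(* A maximizing sequence [x_k] converges, without any appeal to weak
   compactness: with [Q x = lam |x|^2 - |T x|^2 >= 0] on [V] we have
   [lam |x_k - x_l|^2 = Q (x_k - x_l) + |T x_k - T x_l|^2], where
   [Q (x_k - x_l) <= 2 Q x_k + 2 Q x_l] tends to [0]. *)
Lemma compact_max_attained (V : H -> Prop) : compact_op T -> closed_subspace V ->
  exists x, V x /\
    (x = vzero \/ nsq x = 1 /\ 0 < nsq (T x)) /\
    forall h, V h -> nsq (T h) <= nsq (T x) * nsq h.
Proof.
  intros C CV; pose proof (proj1 C) as LT.
  destruct (compact_bounded C) as [L [L0 BL]].
  set (E := fun r => exists h, V h /\ nsq h <= 1 /\ r = nsq (T h)).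
  destruct (completeness E) as [lam [UB LUB]].
  { exists L; intros r [h [_ [H1 ->]]].
    eapply Rle_trans; [apply BL|]. pose proof (nsq_nonneg h); nra. }
  { exists (nsq (T vzero)), vzero; repeat split; [apply (csub_0 _ CV)|].
    rewrite nsq_zero; lra. }
  assert (BV : forall h, V h -> nsq (T h) <= lam * nsq h).
  { apply nsq_linear_le; auto; [apply CV|].
    intros h Vh Hh; apply UB; exists h; auto. }
  assert (P0 : 0 <= lam).
  { apply UB; exists vzero; rewrite linear_0, nsq_zero by auto.
    repeat split; [apply (csub_0 _ CV)|lra]. }
  (* If the supremum is 0, [T] vanishes on [V] and the zero vector serves; this is how the singular
     vectors of a finite-rank operator become zero. *)
  destruct P0 as [P|<-].
  2:{ exists vzero; repeat split; [apply (csub_0 _ CV)|left; reflexivity|].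
      intros h Vh; rewrite linear_0, nsq_zero by auto; apply BV, Vh. }
  assert (AP : forall n : nat, exists h, V h /\ nsq h <= 1 /\
                 lam - / INR (Datatypes.S n) < nsq (T h)).
  { intros n; apply NNPP; intros N.
    assert (Pn : 0 < / INR (Datatypes.S n)) by (apply Rinv_0_lt_compat, lt_0_INR; lia).
    assert (lam <= lam - / INR (Datatypes.S n)); [|lra].
    apply LUB; intros r [h [Vh [Hh ->]]].
    apply Rnot_lt_le; intros Lt; apply N; exists h; auto. }
  destruct (choice _ AP) as [w Hw].
  destruct (compact_subseq w 1 C) as [phi [y [Pphi Y]]]; [intros; apply Hw|].
  set (x := fun k => w (phi k)).
  assert (Qx : forall k, lam * nsq (x k) - nsq (T (x k)) < / INR (Datatypes.S k)).
  { intros k; destruct (Hw (phi k)) as [_ [H1 H2]].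
    assert (/ INR (Datatypes.S (phi k)) <= / INR (Datatypes.S k)).
    { apply Rinv_le_contravar; [apply lt_0_INR; lia|].
      apply le_INR; pose proof (strict_mono_ge phi Pphi k); lia. }
    unfold x; nra. }
  assert (Vx : forall k, V (x k)) by (intros; apply Hw).
  destruct (cauchy_vconv x) as [z Z].
  { intros e He.
    (* The two values of Q, each below lam e / 8 and doubled, cost lam e / 2; the images [T (x n)]
       and [T (x m)] account for the other lam e / 2. *)
    assert (Pe : 0 < lam * e / 8) by nra.
    destruct (archimed_cor1 _ Pe) as [N1 [HN1 PN1]].
    assert (Pe2 : 0 < lam * e / 2) by nra.
    destruct (vconv_cauchy _ _ Y _ Pe2) as [N2 HN2].
    exists (Nat.max N1 N2); intros n m Hn Hm.
    assert (A1 := HN2 n m ltac:(lia) ltac:(lia)).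
    fold (x n) in A1; fold (x m) in A1; rewrite <- linear_sub in A1 by auto.
    assert (QB : forall k, (N1 <= k)%nat -> lam * nsq (x k) - nsq (T (x k)) < lam * e / 8).
    { intros k Hk; eapply Rlt_trans; [apply Qx|].
      eapply Rle_lt_trans; [|exact HN1].
      apply Rinv_le_contravar; [apply lt_0_INR, PN1|apply le_INR; lia]. }
    assert (A2 := QB n ltac:(lia)); assert (A3 := QB m ltac:(lia)).
    (* Q is nonnegative at the sum, so the parallelogram law for Q bounds it at the difference. *)
    assert (A4 := BV (vadd (x n) (x m)) ltac:(apply csub_add; auto)).
    rewrite (proj1 LT), !nsq_add in A4.
    rewrite linear_sub, !nsq_sub in A1 by auto.
    apply Rmult_lt_reg_l with lam; [exact P|].
    rewrite nsq_sub; nra. }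
  assert (TZ : vconv (fun k => T (x k)) (T z)) by (apply bounded_vconv with L; auto).
  assert (Vz : V z) by (apply (csub_lim _ CV x); auto).
  assert (N1 : nsq z <= 1).
  { apply (Un_cv_le_const _ _ _ (vconv_nsq _ _ Z)); intros; apply Hw. }
  assert (NT : lam <= nsq (T z)).
  { assert (C1 : Un_cv (fun k => lam - / INR (Datatypes.S k)) (lam - 0)).
    { apply CV_minus; [apply Un_cv_const|apply inv_INR_cv]. }
    rewrite Rminus_0_r in C1; refine (Rle_cv_lim _ C1 (vconv_nsq _ _ TZ)).
    intros k; left; destruct (Hw (phi k)) as [_ [_ H2]].
    assert (/ INR (Datatypes.S (phi k)) <= / INR (Datatypes.S k)).
    { apply Rinv_le_contravar; [apply lt_0_INR; lia|].
      apply le_INR; pose proof (strict_mono_ge phi Pphi k); lia. }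
    unfold x; lra. }
  assert (NT2 := BV z Vz).
  assert (1 <= nsq z) by nra.
  exists z; repeat split; auto.
  - right; split; lra.
  - intros h Vh; eapply Rle_trans; [apply BV, Vh|].
    apply Rmult_le_compat_r; [apply nsq_nonneg|exact NT].
Qed.

(** The form |T x|^2 |h|^2 - |T h|^2 is nonnegative on [V] and vanishes at h = x, so its derivative
    at [x] vanishes in every direction of [V]. *)
Lemma max_stationary (V : H -> Prop) x : linear_op T -> closed_subspace V ->
  V x -> nsq x = 1 -> (forall h, V h -> nsq (T h) <= nsq (T x) * nsq h) ->
  forall h, V h -> inner (T x) (T h) = Cmul (RtoC (nsq (T x))) (inner x h).
Proof.
  intros LT CV Vx N B.
  assert (RE : forall h, V h -> Cre (inner (T x) (T h)) = nsq (T x) * Cre (inner x h)).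
  { intros h Vh; apply Rminus_diag_uniq_sym.
    apply stationary_linear with (nsq (T x) * nsq h - nsq (T h)); intros t.
    assert (A := B (vadd x (vscal (RtoC t) h))
      ltac:(apply csub_add; auto; apply csub_scal; auto)).
    rewrite (proj1 LT), (proj2 LT), !nsq_add, !nsq_scal, !inner_scal_r, N in A.
    unfold Cnorm2 in A; simpl in A; nra. }
  intros h Vh; apply Cx_ext; simpl; [rewrite RE by auto; ring|].
  rewrite !Cim_inner, <- (proj2 LT), RE by (apply csub_scal; auto); ring.
Qed.

End Compact.

(** A greedy recursion in which each choice sees the set of all earlier ones. The set is a predicate
    because it is fed to [orth]; both the singular vectors and Gram-Schmidt are built this way. *)
Lemma dependent_sequence {X : Type} (P : nat -> (X -> Prop) -> X -> Prop) :
  (forall n S, exists x, P n S x) ->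
  exists (u : nat -> X) (S : nat -> X -> Prop),
    (forall n, P n (S n) (u n)) /\
    (forall n y, S n y <-> exists i, (i < n)%nat /\ y = u i).
Proof.
  intros E.
  assert (E' : forall nS : nat * (X -> Prop), exists x, P (fst nS) (snd nS) x).
  { intros [n S]; apply E. }
  destruct (choice _ E') as [step Hstep].
  set (S := nat_rect (fun _ => X -> Prop) (fun _ => False)
              (fun n S y => S y \/ y = step (n, S))).
  exists (fun n => step (n, S n)), S; split.
  - intros n; apply (Hstep (n, S n)).
  - induction n as [|n IH]; intros y; simpl.
    + split; [tauto|intros [i [Hi _]]; lia].
    + rewrite IH; split.
      * intros [[i [Hi ->]]| ->]; [exists i|exists n]; split; auto; lia.
      * intros [i [Hi ->]]; destruct (Nat.eq_dec i n) as [->|Ne]; [right; reflexivity|].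
        left; exists i; split; [lia|reflexivity].
Qed.

(** * Orthonormal systems, their series, and the singular value decomposition *)

Section Orthosystems.
Context {H : Hilbert}.
Implicit Types x y z h : H.

(* Orthonormal systems in which some vectors may be replaced by zero, so that
   finite and infinite systems can both be indexed by [nat]. *)
Definition orthosys (u : nat -> H) : Prop :=
  (forall i j, i <> j -> inner (u i) (u j) = C0) /\
  (forall i, u i = vzero \/ inner (u i) (u i) = C1).

Lemma inner_vsum_l n f z :
  Cre (inner (vsum n f) z) = rsum n (fun i => Cre (inner (f i) z)).
Proof.
  induction n as [|n IH]; simpl; [rewrite inner_0_l; reflexivity|].
  rewrite inner_add; simpl; rewrite IH; reflexivity.
Qed.

(** The choice k = n is allowed and says that a sum of vectors orthogonal to [z] is orthogonal to
    [z]. *)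
Lemma inner_vsum_single n f z k :
  (forall i, (i < n)%nat -> i <> k -> inner (f i) z = C0) ->
  inner (vsum n f) z = if (k <? n)%nat then inner (f k) z else C0.
Proof.
  intros Z; induction n as [|n IH]; simpl; [apply inner_0_l|].
  rewrite inner_add, IH by auto.
  destruct (Nat.ltb_spec k n), (Nat.ltb_spec k (Datatypes.S n)); try lia.
  - rewrite (Z n) by lia; cring.
  - replace n with k by lia; cring.
  - rewrite (Z n) by lia; cring.
Qed.

Lemma linear_vsum (T : H -> H) n f : linear_op T ->
  T (vsum n f) = vsum n (fun i => T (f i)).
Proof.
  intros L; induction n as [|n IH]; simpl; [apply linear_0, L|].
  rewrite (proj1 L), IH; reflexivity.
Qed.

Lemma orthosys_scal_self u x k : orthosys u ->
  inner (vscal (inner x (u k)) (u k)) (u k) = inner x (u k).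
Proof.
  intros [_ O]; destruct (O k) as [-> | E].
  - rewrite !inner_0_r; reflexivity.
  - rewrite inner_scal, E; cring.
Qed.

Lemma orthosys_coef u (c : nat -> Cx) n k : orthosys u ->
  inner (vsum n (fun i => vscal (c i) (u i))) (u k) =
  if (k <? n)%nat then inner (vscal (c k) (u k)) (u k) else C0.
Proof.
  intros [O _]; apply inner_vsum_single; intros i _ N.
  rewrite inner_scal, O by auto; cring.
Qed.

Lemma orthosys_residue u x n k : orthosys u -> (k < n)%nat ->
  inner (vsub x (vsum n (fun i => vscal (inner x (u i)) (u i)))) (u k) = C0.
Proof.
  intros O K; rewrite inner_sub_l, orthosys_coef by auto.
  rewrite (proj2 (Nat.ltb_lt k n) K), orthosys_scal_self by auto; cring.
Qed.

Lemma orthosys_nsq_le u i : orthosys u -> 0 <= nsq (u i) <= 1.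
Proof.
  intros [_ O]; destruct (O i) as [-> | E]; [rewrite nsq_zero; lra|].
  unfold nsq; rewrite E; simpl; lra.
Qed.

Lemma Cnorm2_nonneg a : 0 <= Cnorm2 a.
Proof. unfold Cnorm2; nra. Qed.

Lemma Cnorm2_conj a : Cnorm2 (Cconj a) = Cnorm2 a.
Proof. unfold Cnorm2; simpl; ring. Qed.

(** Pythagoras, as an inequality because a zero vector of the system loses its coefficient. *)
Lemma orthosys_tail_nsq u (c : nat -> Cx) n m : orthosys u -> (n <= m)%nat ->
  nsq (vsub (vsum m (fun i => vscal (c i) (u i))) (vsum n (fun i => vscal (c i) (u i))))
  <= rsum m (fun i => Cnorm2 (c i)) - rsum n (fun i => Cnorm2 (c i)).
Proof.
  intros O L; induction L as [|m L IH]; simpl.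
  { unfold vsub; rewrite vadd_opp, nsq_zero; lra. }
  set (F := fun i => vscal (c i) (u i)) in *.
  replace (vsub (vadd (vsum m F) (vscal (c m) (u m))) (vsum n F))
    with (vadd (vsub (vsum m F) (vsum n F)) (vscal (c m) (u m))) by vring.
  rewrite nsq_add, nsq_scal.
  assert (Z : inner (vsub (vsum m F) (vsum n F)) (vscal (c m) (u m)) = C0).
  { rewrite inner_scal_r, inner_sub_l; unfold F; rewrite !orthosys_coef by auto.
    destruct (Nat.ltb_spec m m), (Nat.ltb_spec m n); try lia; cring. }
  rewrite Z; simpl.
  pose proof (orthosys_nsq_le u m O); pose proof (Cnorm2_nonneg (c m)); nra.
Qed.

Lemma orthosys_series u (c : nat -> Cx) B : orthosys u ->
  (forall n, rsum n (fun i => Cnorm2 (c i)) <= B) ->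
  exists y, vconv (fun n => vsum n (fun i => vscal (c i) (u i))) y.
Proof.
  intros O L; apply cauchy_vconv; intros e He.
  destruct (bounded_rsum_cv (fun i => Cnorm2 (c i)) B) as [l [C _]]; auto.
  { intros; apply Cnorm2_nonneg. }
  destruct (C (e / 2)) as [N HN]; [lra|].
  exists N.
  assert (W : forall n m, (N <= n)%nat -> (n <= m)%nat ->
    nsq (vsub (vsum m (fun i => vscal (c i) (u i))) (vsum n (fun i => vscal (c i) (u i)))) < e).
  { intros n m Hn Hm; eapply Rle_lt_trans; [apply orthosys_tail_nsq; auto|].
    assert (A := HN n Hn); assert (D := HN m ltac:(lia)); unfold R_dist in *.
    apply Rabs_def2 in A; apply Rabs_def2 in D; lra. }
  intros n m Hn Hm; destruct (Nat.le_ge_cases n m).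
  - rewrite nsq_sub_sym; apply W; auto.
  - apply W; auto.
Qed.

Lemma Cmul_inner_sym x v : Cmul (inner x v) (inner v x) = RtoC (Cnorm2 (inner x v)).
Proof. rewrite (inner_conj H x v); unfold Cnorm2; cring. Qed.

Lemma bessel u x n : orthosys u -> rsum n (fun i => Cnorm2 (inner x (u i))) <= nsq x.
Proof.
  intros O; set (y := vsum n (fun i => vscal (inner x (u i)) (u i))).
  assert (YX : Cre (inner y x) = rsum n (fun i => Cnorm2 (inner x (u i)))).
  { unfold y; rewrite inner_vsum_l; apply rsum_ext; intros i _.
    rewrite inner_scal, Cmul_inner_sym; reflexivity. }
  assert (YY : nsq y = Cre (inner y x)).
  { unfold nsq; unfold y at 1; rewrite inner_vsum_l, YX; apply rsum_ext; intros i Hi.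
    rewrite inner_scal; unfold y.
    rewrite (inner_conj H _ (u i)), orthosys_coef by auto.
    rewrite (proj2 (Nat.ltb_lt i n) Hi), orthosys_scal_self by auto.
    unfold Cnorm2; simpl; ring. }
  pose proof (nsq_nonneg (vsub x y)) as P; rewrite nsq_sub, (inner_re_sym y x) in P.
  lra.
Qed.

(** The coefficient along [u k] is not written [c k], since it is 0 when [u k] is zero. The last
    clause places [y] in the closed span of [u]. *)
Lemma orthosys_expansion u (c : nat -> Cx) B : orthosys u ->
  (forall n, rsum n (fun i => Cnorm2 (c i)) <= B) ->
  exists y, vconv (fun n => vsum n (fun i => vscal (c i) (u i))) y /\
    (forall k, inner y (u k) = inner (vscal (c k) (u k)) (u k)) /\
    (forall z, (forall k, inner z (u k) = C0) -> inner y z = C0).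
Proof.
  intros O L; destruct (orthosys_series u c B O L) as [y Y]; exists y; split; [exact Y|split].
  - intros k; apply (vconv_inner_eventually _ _ _ _ Y).
    exists (Datatypes.S k); intros n Hn; rewrite orthosys_coef by auto.
    rewrite (proj2 (Nat.ltb_lt k n)) by lia; reflexivity.
  - intros z Z; apply (vconv_inner_eventually _ _ _ _ Y).
    exists 0%nat; intros n _; rewrite (inner_vsum_single _ _ _ n).
    + destruct (Nat.ltb_spec n n); [lia|reflexivity].
    + intros i _ _; rewrite inner_scal, (inner_0_sym _ _ (Z i)); cring.
Qed.

Lemma orthosys_decomposition u x : orthosys u ->
  exists y, vconv (fun n => vsum n (fun i => vscal (inner x (u i)) (u i))) y /\
    (forall k, inner (vsub x y) (u k) = C0) /\
    (forall z, (forall k, inner z (u k) = C0) -> inner y z = C0).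
Proof.
  intros O; destruct (orthosys_expansion u (fun i => inner x (u i)) (nsq x)) as [y [Y [K P]]]; auto.
  { intros; apply bessel, O. }
  exists y; split; [exact Y|split; [|exact P]].
  intros k; rewrite inner_sub_l, K, orthosys_scal_self by auto; cring.
Qed.

End Orthosystems.

(* [svd_eigen] is the weak form of [T^* T u_n = s_n^2 u_n]; the adjoint is only
   obtained afterwards, from the decomposition. *)
Record svd {H : Hilbert} (T : H -> H) (u : nat -> H) (s : nat -> R) : Prop := {
  svd_orthosys : orthosys u;
  svd_nonneg : forall n, 0 <= s n;
  svd_zero : forall n, u n = vzero <-> s n = 0;
  svd_noninc : forall n, s (Datatypes.S n) <= s n;
  svd_vanish : forall e, 0 < e -> exists n, s n < e;
  svd_eigen : forall n h, inner (T (u n)) (T h) = Cmul (RtoC (s n * s n)) (inner (u n) h);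
  svd_kernel : forall x, (forall n, inner x (u n) = C0) -> T x = vzero }.

Lemma svd_exists {H : Hilbert} (T : H -> H) : compact_op T -> exists u s, svd T u s.
Proof.
  intros C; pose proof (proj1 C) as LT.
  destruct (dependent_sequence (fun (_ : nat) (S : H -> Prop) x =>
    orth S x /\ (x = vzero \/ nsq x = 1 /\ 0 < nsq (T x)) /\
    forall h, orth S h -> nsq (T h) <= nsq (T x) * nsq h)) as [u [S [U HS]]].
  { intros _ S; apply compact_max_attained; [exact C|apply orth_closed]. }
  assert (OS : forall n x, orth (S n) x <-> forall i, (i < n)%nat -> inner x (u i) = C0).
  { intros n x; split.
    - intros X i Hi; apply X, (HS n); exists i; auto.
    - intros X y Y; apply (HS n y) in Y; destruct Y as [i [Hi ->]]; auto. }
  assert (OL : forall i j, (i < j)%nat -> inner (u j) (u i) = C0).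
  { intros i j Hij; exact (proj1 (OS j (u j)) (proj1 (U j)) i Hij). }
  assert (O : orthosys u).
  { split.
    - intros i j N; destruct (Nat.lt_ge_cases i j); [apply inner_0_sym|]; apply OL; lia.
    - intros i; destruct (U i) as [_ [[Z|[N _]] _]]; [left; exact Z|right].
      rewrite inner_self, N; reflexivity. }
  set (s := fun n => vnorm (T (u n))).
  assert (SS : forall n, s n * s n = nsq (T (u n))) by (intros; apply (vnorm_nsq (T (u n)))).
  assert (S0 : forall n, 0 <= s n) by (intros; apply vnorm_nonneg).
  assert (ANTI : forall n, s (Datatypes.S n) <= s n).
  { intros n; apply vnorm_le; [apply S0|]; rewrite SS.
    destruct (U n) as [_ [_ B]].
    eapply Rle_trans; [apply B, OS; intros; apply OL; lia|].
    pose proof (orthosys_nsq_le u (Datatypes.S n) O).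
    pose proof (nsq_nonneg (T (u n))); nra. }
  assert (ZS : forall n, u n = vzero <-> s n = 0).
  { intros n; split; intros E.
    - unfold s; rewrite E, linear_0 by auto; unfold vnorm; rewrite inner_0_l; apply sqrt_0.
    - destruct (U n) as [_ [[Z|[_ P]] _]]; [exact Z|]. rewrite <- SS, E in P; lra. }
  (* Stationarity covers only vectors orthogonal to the earlier [u i]. The component [y] of [h]
     along those is subtracted first; by the induction hypothesis [T y] is orthogonal to
     [T (u n)]. *)
  assert (EIG : forall n h, inner (T (u n)) (T h) = Cmul (RtoC (s n * s n)) (inner (u n) h)).
  { induction n as [n IH] using (well_founded_ind Nat.lt_wf_0); intros h.
    destruct (U n) as [On [[Z|[N P]] B]].
    { rewrite Z, linear_0, !inner_0_l by auto; cring. }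
    set (y := vsum n (fun i => vscal (inner h (u i)) (u i))).
    assert (Oz : orth (S n) (vsub h y)).
    { apply OS; intros i Hi; apply orthosys_residue; auto. }
    assert (E := max_stationary T _ (u n) LT (orth_closed (S n)) On N B _ Oz).
    rewrite SS.
    assert (Y1 : inner y (u n) = C0).
    { unfold y; rewrite orthosys_coef by auto.
      destruct (Nat.ltb_spec n n); [lia|reflexivity]. }
    assert (Y2 : inner (T y) (T (u n)) = C0).
    { unfold y; rewrite linear_vsum by auto.
      rewrite (inner_vsum_single _ _ _ n).
      - destruct (Nat.ltb_spec n n); [lia|reflexivity].
      - intros i Hi _; rewrite (proj2 LT), inner_scal, IH by auto.
        rewrite (proj1 O i n) by lia; cring. }
    rewrite linear_sub, !inner_sub_r, (inner_0_sym _ _ Y1), (inner_0_sym _ _ Y2) in E by auto.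
    apply (f_equal Cre) in E as E1; apply (f_equal Cim) in E as E2; simpl in E1, E2.
    apply Cx_ext; simpl; lra. }
  assert (DEC : forall n m, (n <= m)%nat -> s m <= s n).
  { intros n m L; induction L as [|m L IH]; [lra|specialize (ANTI m); lra]. }
  (* The images [T (u n)] are pairwise orthogonal, so if all [s n] were at least e, they would keep
     squared distances of at least 2 e^2 and no subsequence would converge. *)
  assert (VAN : forall e, 0 < e -> exists n, s n < e).
  { intros e He; apply NNPP; intros N.
    assert (GE : forall n, e <= s n).
    { intros n; apply Rnot_lt_le; intros L; apply N; exists n; exact L. }
    destruct (compact_subseq T u 1 C) as [phi [y [P Y]]].
    { intros n; apply orthosys_nsq_le, O. }
    destruct (vconv_cauchy _ _ Y (e * e)) as [M HM]; [nra|].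
    assert (A := HM M (Datatypes.S M) ltac:(lia) ltac:(lia)).
    rewrite nsq_sub, <- !SS, EIG, (proj1 O) in A by (specialize (P M); lia).
    simpl in A; pose proof (GE (phi M)); pose proof (GE (phi (Datatypes.S M))); nra. }
  exists u, s; split; auto.
  intros x X; apply nsq_0_eq, Rnot_lt_le; intros P.
  (* Here |T x| <= s_n |x| for every n. With this e, any s_n < e gives |T x|^2 <= e^2 |x|^2 < e^2
     (|x|^2 + 1) = |T x|^2. *)
  set (e := sqrt (nsq (T x) / (nsq x + 1))).
  pose proof (nsq_nonneg x).
  assert (Pq : 0 < nsq (T x) / (nsq x + 1)) by (apply Rdiv_lt_0_compat; lra).
  assert (Pe : 0 < e) by (apply sqrt_lt_R0, Pq).
  assert (E2 : e * e * (nsq x + 1) = nsq (T x)).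
  { unfold e; rewrite sqrt_def by lra; field; lra. }
  destruct (VAN e Pe) as [n Hn].
  destruct (U n) as [_ [_ B]].
  assert (A := B x ltac:(apply OS; auto)); rewrite <- SS in A.
  pose proof (S0 n); assert (s n * s n <= e * e) by nra. nra.
Qed.

(** * Nonincreasing sequences and the sizes of their level sets *)

Lemma noninc_le (s : nat -> R) :
  (forall n, s (Datatypes.S n) <= s n) -> forall n m, (n <= m)%nat -> s m <= s n.
Proof.
  intros D n m L; induction L as [|m L IH]; [lra|specialize (D m); lra].
Qed.

Lemma up_closed_threshold (P : nat -> Prop) :
  (forall n m, (n <= m)%nat -> P n -> P m) -> (exists n, P n) ->
  exists k, forall n, P n <-> (k <= n)%nat.
Proof.
  intros UP [N PN]; induction N as [|N IH].
  - exists 0%nat; intros n; split; [lia|intros _; apply (UP 0%nat); [lia|exact PN]].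
  - destruct (classic (P N)) as [Q|Q]; [apply IH, Q|].
    exists (Datatypes.S N); intros n; split.
    + intros Pn; apply Nat.nle_gt; intros L; apply Q, (UP n); auto.
    + intros L; apply (UP (Datatypes.S N)); auto.
Qed.

(** At the first index n of disagreement let mu be the larger value. The sequence with the smaller
    value takes mu only before n, where both agree, so the other takes mu at least once more, namely
    at n. *)
Lemma noninc_eq_of_levels (s s' : nat -> R) :
  (forall n, 0 <= s n) -> (forall n, 0 <= s' n) ->
  (forall n, s (Datatypes.S n) <= s n) -> (forall n, s' (Datatypes.S n) <= s' n) ->
  (forall mu, 0 < mu -> exists m k k',
     (forall n, s n = mu <-> (k <= n < k + m)%nat) /\
     (forall n, s' n = mu <-> (k' <= n < k' + m)%nat)) ->
  forall n, s n = s' n.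
Proof.
  intros P P' D D' L.
  assert (W : forall (r r' : nat -> R), (forall n, 0 <= r n) ->
    (forall n, r (Datatypes.S n) <= r n) ->
    forall n, (forall i, (i < n)%nat -> r i = r' i) ->
    (exists m k k', (forall i, r i = r' n <-> (k <= i < k + m)%nat) /\
       (forall i, r' i = r' n <-> (k' <= i < k' + m)%nat)) ->
    ~ r n < r' n).
  { intros r r' Pr Dr n EQ [m [k [k' [A B]]]] Lt.
    assert (Bn := proj1 (B n) eq_refl).
    assert (SUB : forall i, (k <= i < k + m)%nat -> (i < n)%nat /\ (k' <= i < k' + m)%nat).
    { intros i Hi; apply A in Hi.
      assert (i < n)%nat.
      { apply Nat.nle_gt; intros Ln; pose proof (noninc_le r Dr n i Ln); lra. }
      split; [assumption|apply B; rewrite <- EQ; auto]. }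
    pose proof (SUB k ltac:(lia)); pose proof (SUB (k + m - 1)%nat ltac:(lia)); lia. }
  intros n; induction n as [n IH] using (well_founded_ind Nat.lt_wf_0).
  destruct (Rtotal_order (s n) (s' n)) as [Lt|[E|Gt]]; [exfalso|exact E|exfalso].
  - apply (W s s' P D n IH); [|exact Lt].
    apply L; specialize (P n); lra.
  - apply (W s' s P' D' n); [intros; symmetry; auto| |exact Gt].
    destruct (L (s n)) as [m [k [k' [A B]]]]; [specialize (P' n); lra|].
    exists m, k', k; split; assumption.
Qed.

(** * Closed spans and identification of vectors by their coefficients *)

Section Spans.
Context {H : Hilbert}.
Implicit Types x y z h : H.

(* The closed linear span of [u], as its double orthogonal complement. *)
Definition in_span (u : nat -> H) y : Prop :=
  forall z, (forall k, inner z (u k) = C0) -> inner y z = C0.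

(** The difference is orthogonal to every [u k], hence to [y] and [y'], hence to itself. Operator
    identities below are reduced to coefficients through this. *)
Lemma span_unique u y y' : in_span u y -> in_span u y' ->
  (forall k, inner y (u k) = inner y' (u k)) -> y = y'.
Proof.
  intros S S' E.
  assert (O : forall k, inner (vsub y y') (u k) = C0).
  { intros k; rewrite inner_sub_l, E; cring. }
  apply vsub_0_eq, nsq_0_eq; unfold nsq.
  rewrite inner_sub_l, S, S' by auto; simpl; lra.
Qed.

Lemma in_span_add u y y' : in_span u y -> in_span u y' -> in_span u (vadd y y').
Proof. intros S S' z Z; rewrite inner_add, S, S' by auto; cring. Qed.

Lemma in_span_scal u a y : in_span u y -> in_span u (vscal a y).
Proof. intros S z Z; rewrite inner_scal, S by auto; cring. Qed.

Lemma in_span_self u k : in_span u (u k).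
Proof. intros z Z; apply inner_0_sym, Z. Qed.

Lemma in_span_vsum u n f : (forall i, in_span u (f i)) -> in_span u (vsum n f).
Proof.
  intros S; induction n as [|n IH]; simpl; [intros z _; apply inner_0_l|].
  apply in_span_add; auto.
Qed.

Lemma vconv_inner_eq (v w : nat -> H) x y a b :
  vconv v x -> vconv w y -> (forall n, inner (v n) a = inner (w n) b) ->
  inner x a = inner y b.
Proof.
  intros V W E; apply Cx_ext.
  - apply (UL_sequence (fun n => Cre (inner (v n) a))); [apply vconv_inner_re, V|].
    eapply Un_cv_ext; [|apply vconv_inner_re, W]; intros n; simpl; rewrite E; reflexivity.
  - apply (UL_sequence (fun n => Cim (inner (v n) a))); [apply vconv_inner_im, V|].
    eapply Un_cv_ext; [|apply vconv_inner_im, W]; intros n; simpl; rewrite E; reflexivity.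
Qed.

End Spans.

(** * Adjoint, modulus and singular values read off from the decomposition *)

Section SVD.
Context {H : Hilbert} (T : H -> H) (u : nat -> H) (s : nat -> R).
Implicit Types x y z h : H.

Lemma svd_unit k : svd T u s -> 0 < s k -> inner (u k) (u k) = C1.
Proof.
  intros D P; destruct (proj2 (svd_orthosys _ _ _ D) k) as [Z|E]; [|exact E].
  apply (svd_zero _ _ _ D) in Z; lra.
Qed.

(** [x0] is the projection of [x] on the closed span of [u]; the remainder is killed by [T]. *)
Lemma svd_restrict x : linear_op T -> svd T u s ->
  exists x0, vconv (fun n => vsum n (fun i => vscal (inner x (u i)) (u i))) x0 /\
    T x0 = T x /\ forall y, in_span u y -> inner x0 y = inner x y.
Proof.
  intros L D; destruct (orthosys_decomposition u x (svd_orthosys _ _ _ D)) as [x0 [X [O S]]].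
  exists x0; split; [exact X|split].
  - symmetry; apply vsub_0_eq; rewrite <- linear_sub by auto.
    apply (svd_kernel _ _ _ D), O.
  - intros y Y; specialize (Y _ O); apply inner_0_sym in Y.
    rewrite inner_sub_l in Y.
    apply (f_equal Cre) in Y as E1; apply (f_equal Cim) in Y as E2; simpl in *.
    apply Cx_ext; lra.
Qed.

(** Expands [x0] in <T x0, T x> = |T x|^2; [svd_eigen] turns each <T u_i, T x> into s_i^2 <u_i,
    x>. *)
Lemma svd_nsq_image x : compact_op T -> svd T u s ->
  Un_cv (fun n => rsum n (fun i => s i * s i * Cnorm2 (inner x (u i)))) (nsq (T x)).
Proof.
  intros C D; destruct (compact_bounded T C) as [L [_ B]].
  destruct (svd_restrict x (proj1 C) D) as [x0 [X [E _]]].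
  apply (bounded_vconv T L) in X; [|apply C|exact B].
  apply (vconv_inner_re _ _ (T x)) in X; rewrite E in X.
  eapply Un_cv_ext; [|exact X]; intros n; simpl.
  rewrite linear_vsum, inner_vsum_l by apply C; apply rsum_ext; intros i _.
  rewrite (proj2 (proj1 C)), inner_scal, (svd_eigen _ _ _ D), (inner_conj H x (u i)).
  unfold Cnorm2; simpl; ring.
Qed.

Lemma svd_le_first k : svd T u s -> s k <= s 0%nat.
Proof. intros D; apply noninc_le; [apply (svd_noninc _ _ _ D)|lia]. Qed.

(** [M x] is the series of s_i <x, u_i> u_i, which converges by Bessel because s_i <= s_0. The last
    two clauses determine [M x] uniquely. *)
Lemma svd_modulus_exists : svd T u s ->
  exists M : H -> H, forall x,
    vconv (fun n => vsum n (fun i => vscal (Cmul (RtoC (s i)) (inner x (u i))) (u i))) (M x) /\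
    (forall k, inner (M x) (u k) = Cmul (RtoC (s k)) (inner x (u k))) /\
    in_span u (M x).
Proof.
  intros D; apply (choice (fun x y => vconv _ y /\ (forall k, inner y (u k) = _) /\ in_span u y)).
  intros x; pose proof (svd_orthosys _ _ _ D) as O.
  destruct (orthosys_expansion u (fun i => Cmul (RtoC (s i)) (inner x (u i)))
    (s 0%nat * s 0%nat * nsq x) O) as [y [Y [K S]]].
  - intros n.
    apply Rle_trans with (rsum n (fun i => s 0%nat * s 0%nat * Cnorm2 (inner x (u i)))).
    + apply rsum_le; intros i _.
      replace (Cnorm2 (Cmul (RtoC (s i)) (inner x (u i))))
        with (s i * s i * Cnorm2 (inner x (u i))) by (unfold Cnorm2; simpl; ring).
      apply Rmult_le_compat_r; [apply Cnorm2_nonneg|].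
      pose proof (svd_nonneg _ _ _ D i); pose proof (svd_le_first i D); nra.
    + rewrite rsum_scal; apply Rmult_le_compat_l; [nra|apply bessel, O].
  - exists y; split; [exact Y|split; [|exact S]].
    intros k; rewrite K, inner_scal.
    destruct (proj2 O k) as [-> | E]; [rewrite !inner_0_r|rewrite E]; cring.
Qed.

(** An adjoint is forced to have the coefficients <y, T u_k>, and its values stay in the span of [u]
    because [T] vanishes on the complement. *)
Lemma svd_adjoint_exists : compact_op T -> svd T u s ->
  exists A : H -> H, forall y,
    (forall k, inner (A y) (u k) = inner y (T (u k))) /\ in_span u (A y).
Proof.
  intros C D; apply (choice (fun y z => (forall k, inner z (u k) = _) /\ in_span u z)).
  intros y; pose proof (svd_orthosys _ _ _ D) as O.
  destruct (compact_bounded T C) as [L [L0 B]].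
  destruct (orthosys_expansion u (fun i => inner y (T (u i))) (nsq y * L) O)
    as [z [_ [K S]]].
  - intros n; set (f := fun i => Cnorm2 (inner y (T (u i)))).
    set (w := vsum n (fun i => vscal (inner y (T (u i))) (u i))).
    (* [<T w, y> = sum |<y, T u_i>|^2] bounds [|w|^2], so Cauchy-Schwarz closes. *)
    assert (E1 : Cre (inner (T w) y) = rsum n f).
    { unfold w; rewrite linear_vsum, inner_vsum_l by apply C; apply rsum_ext; intros i _.
      rewrite (proj2 (proj1 C)), inner_scal, Cmul_inner_sym; reflexivity. }
    assert (E2 : nsq w <= rsum n f).
    { pose proof (orthosys_tail_nsq u (fun i => inner y (T (u i))) 0 n O ltac:(lia)) as Q.
      simpl in Q; fold w in Q; fold f in Q.
      replace (vsub w vzero) with w in Q by vring; lra. }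
    pose proof (cauchy_schwarz_re (T w) y) as CS; rewrite E1 in CS.
    pose proof (B w); pose proof (nsq_nonneg y); pose proof (nsq_nonneg w).
    assert (F0 : 0 <= rsum n f) by (apply rsum_nonneg; intros; apply Cnorm2_nonneg).
    assert (nsq (T w) * nsq y <= L * rsum n f * nsq y) by (apply Rmult_le_compat_r; nra).
    destruct F0 as [F0|F0]; [|rewrite <- F0; nra].
    apply Rmult_le_reg_r with (rsum n f); [exact F0|nra].
  - exists z; split; [|exact S].
    intros k; rewrite K, inner_scal.
    destruct (proj2 O k) as [E | E]; [|rewrite E; cring].
    rewrite E, (linear_0 T (proj1 C)), !inner_0_r; cring.
Qed.

Lemma svd_adjoint (A : H -> H) : compact_op T -> svd T u s ->
  (forall y, (forall k, inner (A y) (u k) = inner y (T (u k))) /\ in_span u (A y)) ->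
  is_adjoint T A.
Proof.
  intros C D HA x y; destruct (compact_bounded T C) as [L [_ B]].
  destruct (svd_restrict x (proj1 C) D) as [x0 [X [E S]]].
  rewrite <- E, <- S by apply HA.
  assert (TX := bounded_vconv T L _ _ (proj1 C) B X).
  apply (vconv_inner_eq _ _ _ _ _ _ TX X); intros n; simpl.
  rewrite linear_vsum by apply C.
  induction n as [|n IH]; simpl; [rewrite !inner_0_l; reflexivity|].
  rewrite !inner_add, IH, (proj2 (proj1 C)), !inner_scal.
  rewrite (inner_conj H (A y) (u n)), (proj1 (HA y)), (inner_conj H y (T (u n))).
  reflexivity.
Qed.

Lemma svd_singular_values : compact_op T -> svd T u s -> singular_values T s.
Proof.
  intros C D; pose proof (svd_orthosys _ _ _ D) as O; pose proof (svd_nonneg _ _ _ D) as P.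
  destruct (svd_modulus_exists D) as [M HM].
  destruct (svd_adjoint_exists C D) as [A HA].
  exists M; split; [|split; [exact P|split; [apply (svd_noninc _ _ _ D)|]]].
  - split; [split; [split|]|].
    + intros x y; apply (span_unique u); [apply HM|apply in_span_add; apply HM|].
      intros k; rewrite inner_add, !(proj1 (proj2 (HM _))), inner_add; cring.
    + intros a x; apply (span_unique u); [apply HM|apply in_span_scal; apply HM|].
      intros k; rewrite inner_scal, !(proj1 (proj2 (HM _))), inner_scal; cring.
    + intros x; destruct (HM x) as [V _].
      assert (E : forall n, inner (vsum n (fun i =>
          vscal (Cmul (RtoC (s i)) (inner x (u i))) (u i))) x
        = RtoC (rsum n (fun i => s i * Cnorm2 (inner x (u i))))).
      { induction n as [|n IH]; simpl; [rewrite inner_0_l; reflexivity|].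
        rewrite inner_add, IH, inner_scal, (inner_conj H x (u n)); unfold Cnorm2; cring. }
      split.
      * apply (UL_sequence _ _ _ (vconv_inner_im _ _ x V)).
        eapply Un_cv_ext; [|apply (Un_cv_const 0)]; intros n; simpl; rewrite E; reflexivity.
      * refine (Rle_cv_lim _ (Un_cv_const 0) (vconv_inner_re _ _ x V)).
        intros n; rewrite E; simpl; apply rsum_nonneg; intros i.
        apply Rmult_le_pos; [apply P|apply Cnorm2_nonneg].
    + exists A; split; [apply svd_adjoint; auto|].
      intros x; apply (span_unique u); [apply HM|apply HA|].
      intros k; rewrite !(proj1 (proj2 (HM _))), (proj1 (HA _)).
      rewrite (inner_conj H (T (u k)) (T x)), (svd_eigen _ _ _ D), (inner_conj H x (u k)).
      cring.
  - intros mu Pmu.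
    pose proof (noninc_le s (svd_noninc _ _ _ D)) as DEC.
    destruct (svd_vanish _ _ _ D mu Pmu) as [N HN].
    (* The level set of mu is the interval from k1, where [s] first drops to at most mu, up to k2,
       where it first drops below mu. It may be empty, and it is finite because [s] gets below
       mu. *)
    destruct (up_closed_threshold (fun n => s n <= mu)) as [k1 K1].
    { intros n m L; specialize (DEC n m L); lra. }
    { exists N; lra. }
    destruct (up_closed_threshold (fun n => s n < mu)) as [k2 K2].
    { intros n m L; specialize (DEC n m L); lra. }
    { exists N; exact HN. }
    assert (LEV : forall n, s n = mu <-> (k1 <= n < k1 + (k2 - k1))%nat).
    { assert (k1 <= k2)%nat by (apply K1; left; apply K2; lia).
      intros n; split.
      - intros E; assert (k1 <= n)%nat by (apply K1; lra).
        assert (~ (k2 <= n)%nat) by (rewrite <- K2; lra). lia.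
      - intros Hn; assert (s n <= mu) by (apply K1; lia).
        assert (~ s n < mu) by (rewrite K2; lia). lra. }
    exists (k2 - k1)%nat, k1; split; [|exact LEV].
    set (m := (k2 - k1)%nat) in *.
    assert (ML : forall i, (i < m)%nat -> s (k1 + i)%nat = mu) by (intros; apply LEV; lia).
    exists (fun i => u (k1 + i)%nat); split; [|split].
    + intros i j Hi Hj; destruct (Nat.eqb_spec i j) as [->|Ne].
      * apply svd_unit; [exact D|rewrite ML; auto].
      * apply (proj1 O); lia.
    + intros i Hi; apply (span_unique u); [apply HM|apply in_span_scal, in_span_self|].
      intros k; rewrite (proj1 (proj2 (HM _))), inner_scal.
      destruct (Nat.eq_dec (k1 + i) k) as [<-|Ne]; [rewrite ML by auto; reflexivity|].
      rewrite (proj1 O) by auto; cring.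
    + intros x E.
      (* Since mu > 0, [x] equals [M x] divided by mu, which puts it in the closed span of [u]. *)
      assert (COEF : forall z, inner x z = Cmul (RtoC (/ mu)) (inner (M x) z)).
      { intros z; rewrite E, inner_scal; apply Cx_ext; simpl; field; lra. }
      apply (span_unique u).
      * intros z Z; rewrite COEF, (proj2 (proj2 (HM x))) by exact Z; cring.
      * apply in_span_vsum; intros; apply in_span_scal, in_span_self.
      * intros k; destruct (Req_dec (s k) mu) as [Ek|Nk].
        -- assert (Hk := proj1 (LEV k) Ek).
           rewrite (inner_vsum_single _ _ _ (k - k1)).
           ++ rewrite (proj2 (Nat.ltb_lt _ _)) by lia.
              replace (k1 + (k - k1))%nat with k by lia.
              rewrite orthosys_scal_self by exact O; reflexivity.
           ++ intros i _ Ne; rewrite inner_scal, (proj1 O) by lia; cring.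
        -- transitivity C0.
           ++ pose proof (COEF (u k)) as Q; rewrite (proj1 (proj2 (HM x))) in Q.
              apply (f_equal Cre) in Q as Q1; apply (f_equal Cim) in Q as Q2.
              simpl in Q1, Q2.
              (* [M] multiplies the coefficient along [u k] by [s k], so an eigenvector for mu has
                 coefficient 0 wherever [s k] differs from mu. *)
              assert (Z : forall r, r = / mu * (s k * r) -> r = 0).
              { intros r Er; apply (f_equal (Rmult mu)) in Er.
                rewrite <- Rmult_assoc, Rinv_r, Rmult_1_l in Er by lra.
                apply Rmult_eq_reg_l with (mu - s k); lra. }
              apply Cx_ext; simpl; apply Z; lra.
           ++ rewrite (inner_vsum_single _ _ _ m).
              ** destruct (Nat.ltb_spec m m); [lia|reflexivity].
              ** intros i Hi _; rewrite inner_scal, (proj1 O); [cring|].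
                 intros Ei; apply Nk; rewrite <- Ei; auto.
Qed.

End SVD.

(** * Independence of the singular values from the chosen modulus *)

Section Uniqueness.
Context {H : Hilbert} (T : H -> H).
Implicit Types x y z h : H.

(** The right side does not mention [M], so the eigenspace depends on [T] and mu only. For the
    converse, y = M x - mu x satisfies M y = - mu y, and positivity of [M] forces y = 0. *)
Lemma modulus_eigen (M : H -> H) mu x : is_modulus T M -> 0 < mu ->
  (M x = vscal (RtoC mu) x <->
   forall h, inner (T x) (T h) = Cmul (RtoC (mu * mu)) (inner x h)).
Proof.
  intros [[L P] [A [AD SQ]]] Pmu.
  assert (K : forall h, inner (M (M x)) h = inner (T x) (T h)).
  { intros h; rewrite SQ, (inner_conj H h), <- AD, (inner_conj H (T x)); cring. }
  split.
  - intros E h; rewrite <- K, E, (proj2 L), E, !inner_scal; cring.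
  - intros E.
    assert (E2 : M (M x) = vscal (RtoC (mu * mu)) x).
    { apply inner_ext; intros h; rewrite K, E, inner_scal; reflexivity. }
    set (y := vsub (M x) (vscal (RtoC mu) x)).
    assert (Y : M y = vscal (RtoC (- mu)) y).
    { unfold y; rewrite linear_sub, (proj2 L), E2 by exact L; vring. }
    pose proof (proj2 (P y)) as Q; rewrite Y, inner_scal, inner_self in Q; simpl in Q.
    pose proof (nsq_nonneg y).
    apply vsub_0_eq, nsq_0_eq; fold y; nra.
Qed.

Lemma eigen_dim_transfer (M M' : H -> H) mu m : is_modulus T M -> is_modulus T M' ->
  0 < mu -> eigen_dim M mu m -> eigen_dim M' mu m.
Proof.
  intros I I' P [v [O [E S]]]; exists v; split; [exact O|split].
  - intros i Hi; apply modulus_eigen, (modulus_eigen M); auto.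
  - intros x X; apply S; apply modulus_eigen, (modulus_eigen M'); auto.
Qed.

(** Expanding each system in the other shows that both dimensions equal the double sum of |<v_i,
    v'_j>|^2. *)
Lemma eigen_dim_unique (M : H -> H) mu m m' :
  eigen_dim M mu m -> eigen_dim M mu m' -> m = m'.
Proof.
  intros [v [O [E S]]] [v' [O' [E' S']]].
  assert (G : forall n n' (w w' : nat -> H),
    (forall i j, (i < n)%nat -> (j < n)%nat ->
       inner (w i) (w j) = if Nat.eqb i j then C1 else C0) ->
    (forall i, (i < n)%nat -> w i = vsum n' (fun j => vscal (inner (w i) (w' j)) (w' j))) ->
    INR n = rsum n (fun i => rsum n' (fun j => Cnorm2 (inner (w i) (w' j))))).
  { intros n n' w w' Ow Sw.
    rewrite <- (Rmult_1_r (INR n)), <- (rsum_const n 1); apply rsum_ext; intros i Hi.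
    assert (N : Cre (inner (w i) (w i)) = 1).
    { rewrite Ow by auto; rewrite Nat.eqb_refl; reflexivity. }
    rewrite <- N; rewrite (Sw i Hi) at 1; rewrite inner_vsum_l; apply rsum_ext; intros j _.
    rewrite inner_scal, Cmul_inner_sym; reflexivity. }
  apply INR_eq.
  rewrite (G m m' v v' O) by (intros; apply S', E; auto).
  rewrite (G m' m v' v O') by (intros; apply S, E'; auto).
  rewrite rsum_exchange; apply rsum_ext; intros j _; apply rsum_ext; intros i _.
  rewrite (inner_conj H (v' j) (v i)); apply Cnorm2_conj.
Qed.

Lemma singular_values_unique s s' :
  singular_values T s -> singular_values T s' -> forall n, s n = s' n.
Proof.
  intros [M [I [P [D L]]]] [M' [I' [P' [D' L']]]].
  apply noninc_eq_of_levels; auto.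
  intros mu Pmu; destruct (L mu Pmu) as [m [k [E K]]]; destruct (L' mu Pmu) as [m' [k' [E' K']]].
  apply (eigen_dim_transfer M' M) in E'; auto.
  rewrite (eigen_dim_unique M mu m' m E' E) in K'.
  exists m, k, k'; split; assumption.
Qed.

End Uniqueness.

(** * Real powers and the tangent-line inequality *)

Section Powers.

Lemma rpow_nonneg x q : 0 <= rpow x q.
Proof.
  unfold rpow; destruct (Rle_dec x 0); [lra|left; apply exp_pos].
Qed.

Lemma rpow_pos x q : 0 < x -> rpow x q = Rpower x q.
Proof. intros P; unfold rpow; destruct (Rle_dec x 0); [lra|reflexivity]. Qed.

Lemma rpow_0 q : rpow 0 q = 0.
Proof. unfold rpow; destruct (Rle_dec 0 0); [reflexivity|lra]. Qed.

Lemma rpow_sqr a p : 0 <= a -> rpow (a * a) (p / 2) = rpow a p.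
Proof.
  intros [P|<-]; [|rewrite Rmult_0_l, !rpow_0; reflexivity].
  rewrite !rpow_pos by nra; unfold Rpower; f_equal; rewrite ln_mult by exact P; field.
Qed.

Lemma rpow_mult a b q : 0 <= a -> 0 < b -> rpow (a * b) q = rpow a q * rpow b q.
Proof.
  intros [P|<-] B; [|rewrite Rmult_0_l, !rpow_0; ring].
  rewrite !rpow_pos by nra; rewrite Rpower_mult_distr by auto; reflexivity.
Qed.

Lemma rpow_pred x q : 0 <= x -> rpow x (q - 1) * x = rpow x q.
Proof.
  intros [P|<-]; [|rewrite !rpow_0; ring].
  rewrite !rpow_pos by auto; rewrite <- (Rpower_1 x) at 2 by auto.
  rewrite <- Rpower_plus; f_equal; ring.
Qed.

Lemma ln_le_sub1 x : 0 < x -> ln x <= x - 1.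
Proof.
  intros P; pose proof (exp_ineq1_le (ln x)) as E; rewrite exp_ln in E by auto; lra.
Qed.

(** Weighted AM-GM: [m] is the mean of r^q and 1 with weights 1/q and (q-1)/q, and the claim is r <=
    m. It follows from ln t <= t - 1 at t = r^q / m and t = 1 / m. *)
Lemma bernoulli_Rpower r q : 0 < r -> 1 <= q -> 1 + q * (r - 1) <= Rpower r q.
Proof.
  intros P Q; set (R := Rpower r q).
  assert (PR : 0 < R) by apply exp_pos.
  set (m := (R + q - 1) / q).
  assert (Pm : 0 < m) by (apply Rdiv_lt_0_compat; lra).
  assert (Em : m * q = R + q - 1) by (unfold m; field; lra).
  assert (LR : ln R = q * ln r) by (unfold R, Rpower; apply ln_exp).
  pose proof (ln_le_sub1 (R / m) (Rdiv_lt_0_compat _ _ PR Pm)) as A.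
  pose proof (ln_le_sub1 (/ m) (Rinv_0_lt_compat _ Pm)) as B.
  unfold Rdiv in A; rewrite ln_mult in A by (auto; apply Rinv_0_lt_compat, Pm).
  rewrite ln_Rinv, LR in * by exact Pm.
  assert (S : R * / m + (q - 1) * / m = q).
  { replace (R * / m + (q - 1) * / m) with ((R + q - 1) / m) by (field; lra).
    rewrite <- Em; field; lra. }
  assert (L : ln r <= ln m) by nra.
  assert (r <= m).
  { apply Rnot_lt_le; intros Lt; apply (ln_increasing m r Pm) in Lt; lra. }
  nra.
Qed.

(** Bernoulli at t / t0, multiplied by t0^q; at t = 0 the left side is (1 - q) t0^q <= 0. *)
Lemma rpow_tangent t t0 q : 0 <= t -> 0 < t0 -> 1 <= q ->
  rpow t0 q + q * rpow t0 (q - 1) * (t - t0) <= rpow t q.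
Proof.
  intros T0 P Q; pose proof (rpow_nonneg t0 q) as N.
  rewrite <- (rpow_pred t0 q) in * by lra.
  destruct T0 as [T0|<-]; [|rewrite rpow_0; nra].
  assert (B := bernoulli_Rpower (t / t0) q (Rdiv_lt_0_compat _ _ T0 P) Q).
  rewrite <- rpow_pos in B by (apply Rdiv_lt_0_compat; auto).
  replace (rpow t q) with (rpow (t / t0) q * rpow t0 q).
  2:{ rewrite <- rpow_mult; [f_equal; field; lra| |exact P].
      left; apply Rdiv_lt_0_compat; auto. }
  rewrite <- (rpow_pred t0 q) by lra.
  apply (Rmult_le_compat_r _ _ _ N) in B.
  replace ((1 + q * (t / t0 - 1)) * (rpow t0 (q - 1) * t0))
    with (rpow t0 (q - 1) * t0 + q * rpow t0 (q - 1) * (t - t0)) in B by (field; lra).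
  exact B.
Qed.

End Powers.

(** * Power sums over frames and an extremal orthonormal basis *)

Section Frames.
Context {H : Hilbert} (T : H -> H).
Implicit Types x y z h : H.

Lemma rpow_vnorm x p : rpow (vnorm x) p = rpow (nsq x) (p / 2).
Proof.
  rewrite <- vnorm_nsq; unfold Rsqr; symmetry; apply rpow_sqr, vnorm_nonneg.
Qed.

Lemma vnorm_zero : vnorm (@vzero H) = 0.
Proof. unfold vnorm; rewrite inner_0_l; apply sqrt_0. Qed.

(** The upper half of the frame inequality, put on partial sums so that no limit has to be named. *)
Definition bessel_seq (f : nat -> H) (C : R) : Prop :=
  forall x N, rsum N (fun n => Cnorm2 (inner x (f n))) <= C * nsq x.

(** The single term |<f_n, f_n>|^2 = |f_n|^4 is already at most C |f_n|^2. *)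
Lemma bessel_seq_nsq f C n : bessel_seq f C -> 0 <= C -> nsq (f n) <= C.
Proof.
  intros B P; assert (A := B (f n) (Datatypes.S n)); simpl in A.
  assert (0 <= rsum n (fun i => Cnorm2 (inner (f n) (f i)))).
  { apply rsum_nonneg; intros; apply Cnorm2_nonneg. }
  rewrite (inner_self (f n)) in A; unfold Cnorm2 at 2 in A; simpl in A.
  pose proof (nsq_nonneg (f n)); nra.
Qed.

(* Jensen's inequality for [t |-> t^(p/2)] with the weights [|<f_n, u_k>|^2], in
   the tangent-line form: it is linear in [|T f_n|^2], so the limit over [k]
   can be taken termwise. *)
Lemma svd_bessel_power_sum u s f C p v : compact_op T -> svd T u s -> 2 <= p -> 0 < C ->
  bessel_seq f C -> (forall K, rsum K (fun k => rpow (s k) p) <= v) ->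
  forall N, rsum N (fun n => rpow (vnorm (T (f n))) p) <= rpow C (p / 2) * v.
Proof.
  intros CT D P2 PC B V N.
  set (q := p / 2); assert (Q : 1 <= q) by (unfold q; lra).
  (* The point of tangency: the weighted sum of the s_k^2 is |T f_n|^2, divided here by the bound C
     on the total weight. *)
  set (t := fun n => nsq (T (f n)) / C).
  assert (T0 : forall n, 0 <= t n).
  { intros n; apply Rmult_le_pos; [apply nsq_nonneg|left; apply Rinv_0_lt_compat, PC]. }
  set (a := fun n k => Cnorm2 (inner (f n) (u k))).
  assert (A0 : forall n k, 0 <= a n k) by (intros; apply Cnorm2_nonneg).
  assert (AC : forall n K, rsum K (a n) <= C).
  { intros n K; eapply Rle_trans; [apply bessel, D|].
    apply bessel_seq_nsq; [exact B|lra]. }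
  set (X := fun n K => rsum K (fun k => s k * s k * a n k)).
  assert (ROW : forall n K, C * ((1 - q) * rpow (t n) q) + q * rpow (t n) (q - 1) * X n K
                 <= rsum K (fun k => rpow (s k) p * a n k)).
  { intros n K; destruct (T0 n) as [Tp|Tz].
    2:{ rewrite <- Tz, !rpow_0.
        replace (C * ((1 - q) * 0) + q * 0 * X n K) with 0 by ring.
        apply rsum_nonneg; intros; apply Rmult_le_pos; [apply rpow_nonneg|apply A0]. }
    apply Rle_trans with (rsum K (fun k => (1 - q) * rpow (t n) q * a n k
      + q * rpow (t n) (q - 1) * (s k * s k * a n k))).
    - rewrite rsum_plus, !rsum_scal; fold (X n K).
      specialize (AC n K); pose proof (rpow_nonneg (t n) q).
      (* The total weight may fall short of C, but it multiplies 1 - q <= 0, so replacing it by C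
         only lowers the left side. *)
      assert (0 <= (C - rsum K (a n)) * ((q - 1) * rpow (t n) q)).
      { apply Rmult_le_pos; [lra|apply Rmult_le_pos; lra]. }
      fold (a n); lra.
    - apply rsum_le; intros k _.
      pose proof (svd_nonneg _ _ _ D k) as Sk.
      pose proof (rpow_tangent (s k * s k) (t n) q ltac:(nra) Tp Q) as TG.
      unfold q at 4 in TG; rewrite rpow_sqr in TG by exact Sk.
      apply (Rmult_le_compat_r _ _ _ (A0 n k)) in TG.
      rewrite <- (rpow_pred (t n) q) in * by lra. lra. }
  assert (ALL : forall K, rsum N (fun n => C * ((1 - q) * rpow (t n) q)
                  + q * rpow (t n) (q - 1) * X n K) <= C * v).
  { intros K; eapply Rle_trans; [apply rsum_le; intros n _; apply ROW|].
    rewrite rsum_exchange.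
    apply Rle_trans with (rsum K (fun k => C * rpow (s k) p)).
    - apply rsum_le; intros k _; rewrite rsum_scal, Rmult_comm.
      apply Rmult_le_compat_r; [apply rpow_nonneg|].
      (* For fixed k the weights are the frame coefficients of [u k], whose sum over n is at most C
         |u_k|^2 <= C. *)
      rewrite (rsum_ext _ _ (fun n => Cnorm2 (inner (u k) (f n)))).
      2:{ intros n _; unfold a; rewrite (inner_conj H (u k)); apply Cnorm2_conj. }
      eapply Rle_trans; [apply B|].
      pose proof (orthosys_nsq_le u k (svd_orthosys _ _ _ D)); nra.
    - rewrite rsum_scal; apply Rmult_le_compat_l; [lra|apply V]. }
  assert (LIM : rsum N (fun n => C * ((1 - q) * rpow (t n) q)
                  + q * rpow (t n) (q - 1) * nsq (T (f n))) <= C * v).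
  { refine (Un_cv_le_const _ _ _ _ ALL).
    apply (Un_cv_rsum N (fun n K => C * ((1 - q) * rpow (t n) q)
                  + q * rpow (t n) (q - 1) * X n K)); intros n _.
    apply CV_plus; [apply Un_cv_const|].
    apply CV_mult; [apply Un_cv_const|apply svd_nsq_image; auto]. }
  assert (TC : forall n, nsq (T (f n)) = t n * C) by (intros; unfold t; field; lra).
  (* In the limit each tangent line is evaluated at its own point of contact and collapses to C
     t_n^q. *)
  rewrite (rsum_ext _ _ (fun n => C * rpow (t n) q)) in LIM.
  2:{ intros n _; rewrite TC, <- (rpow_pred (t n) q) by auto; ring. }
  rewrite rsum_scal in LIM; apply Rmult_le_reg_l in LIM; [|exact PC].
  rewrite (rsum_ext _ _ (fun n => rpow C q * rpow (t n) q)).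
  2:{ intros n _; rewrite rpow_vnorm, TC, rpow_mult by auto; fold q; ring. }
  rewrite rsum_scal; apply Rmult_le_compat_l; [apply rpow_nonneg|exact LIM].
Qed.

Lemma frame_bounds_bessel f c1 c2 : frame_bounds f c1 c2 -> bessel_seq f c2.
Proof.
  intros [_ [_ F]] x N; destruct (F x) as [l [S [_ U]]]; rewrite vnorm_nsq in U.
  eapply Rle_trans; [|exact U]; apply rsum_le_infinite_sum; [|exact S].
  intros; apply Cnorm2_nonneg.
Qed.

(** The infimum is itself a bound: for nonzero [x] the quotient of the partial sum by |x|^2 lies
    below every admissible constant, hence below [B]. *)
Lemma upper_frame_bound_bessel (f : nat -> H) B : upper_frame_bound f B -> B <= 1 ->
  bessel_seq f 1.
Proof.
  intros [_ G] LB x N; set (r := rsum N (fun n => Cnorm2 (inner x (f n)))).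
  assert (P := nsq_nonneg x); destruct (classic (x = vzero)) as [->|Nz].
  - unfold r; rewrite (rsum_ext _ _ (fun _ => 0)), rsum_const, nsq_zero; [lra|].
    intros n _; rewrite inner_0_l; unfold Cnorm2; simpl; ring.
  - assert (P1 : 0 < nsq x) by (apply inner_pos, Nz).
    assert (A : r / nsq x <= B).
    { apply G; intros c2 [c1 F]; apply frame_bounds_bessel in F.
      apply Rmult_le_reg_r with (nsq x); [exact P1|].
      replace (r / nsq x * nsq x) with r by (field; lra); apply F. }
    apply Rmult_le_reg_r with (/ nsq x); [apply Rinv_0_lt_compat, P1|].
    replace (1 * nsq x * / nsq x) with 1 by (field; lra); unfold Rdiv in A; lra.
Qed.

Definition total (u : nat -> H) : Prop := forall x, (forall n, inner x (u n) = C0) -> x = vzero.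

Lemma orthosys_total_parseval u : orthosys u -> total u -> frame_bounds u 1 1.
Proof.
  intros O W; split; [lra|split; [lra|]]; intros x; exists (nsq x); rewrite vnorm_nsq.
  split; [|lra].
  destruct (orthosys_decomposition u x O) as [y [Y [R _]]].
  assert (E : x = y) by (apply vsub_0_eq, W, R); subst y.
  apply infinite_sum_rsum; apply (vconv_inner_re _ _ x) in Y.
  eapply Un_cv_ext; [|exact Y]; intros n; simpl; rewrite inner_vsum_l.
  apply rsum_ext; intros i _; rewrite inner_scal, Cmul_inner_sym; reflexivity.
Qed.

(** Turns a basis indexed by a subset of [nat] into a frame indexed by all of [nat]; the added zeros
    contribute nothing to frame sums or power sums. *)
Definition extend_by_zero (D : nat -> bool) (e : nat -> H) n : H :=
  if D n then e n else vzero.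

Lemma orthonormal_basis_parseval D e : orthonormal_basis D e ->
  frame_bounds (extend_by_zero D e) 1 1.
Proof.
  unfold extend_by_zero; intros [O W]; apply orthosys_total_parseval.
  - split.
    + intros i j N; destruct (D i) eqn:Di; [|apply inner_0_l].
      destruct (D j) eqn:Dj; [|apply inner_0_r].
      rewrite O by auto; apply Nat.eqb_neq in N; rewrite N; reflexivity.
    + intros i; destruct (D i) eqn:Di; [right|left; reflexivity].
      rewrite O by auto; rewrite Nat.eqb_refl; reflexivity.
  - intros x X; apply W; intros n Dn; specialize (X n); rewrite Dn in X; exact X.
Qed.

Lemma rpow_extend_by_zero D e p n : linear_op T ->
  rpow (vnorm (T (extend_by_zero D e n))) p = if D n then rpow (vnorm (T (e n))) p else 0.
Proof.
  intros L; unfold extend_by_zero; destruct (D n); [reflexivity|].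
  rewrite linear_0, vnorm_zero, rpow_0 by exact L; reflexivity.
Qed.

Lemma parseval_upper_frame_bound (f : nat -> H) : frame_bounds f 1 1 ->
  exists B, upper_frame_bound f B /\ B <= 1.
Proof.
  intros F.
  (* Negated constants again: they are bounded above by 0, and minus their supremum is the upper
     frame bound. *)
  destruct (completeness (fun r => exists c1, frame_bounds f c1 (- r))) as [m [UB LUB]].
  - exists 0; intros r [c1 [P [L _]]]; lra.
  - exists (-1), 1; replace (- -1) with 1 by ring; exact F.
  - exists (- m); split; [split|].
    + intros c2 [c1 F']; assert (- c2 <= m); [|lra].
      apply UB; exists c1; rewrite Ropp_involutive; exact F'.
    + intros b Hb; assert (m <= - b); [|lra].
      apply LUB; intros r Hr; specialize (Hb _ Hr); lra.
    + assert (-1 <= m); [|lra]. apply UB; exists 1; replace (- -1) with 1 by ring; exact F.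
Qed.

(* Gram-Schmidt applied to a dense sequence inside the orthogonal complement of [u]. *)
Lemma orthosys_complement (u : nat -> H) : @separable H ->
  exists g : nat -> H, orthosys g /\ (forall n k, inner (g n) (u k) = C0) /\
    forall x, (forall k, inner x (u k) = C0) -> (forall n, inner x (g n) = C0) -> x = vzero.
Proof.
  intros [d Hd].
  set (V := fun S : H -> Prop => orth (fun y => S y \/ exists k, y = u k)).
  destruct (dependent_sequence (fun n S g => V S g /\ (g = vzero \/ inner g g = C1) /\
    forall x, V S x -> inner x g = C0 -> inner x (d n) = C0)) as [g [S [G HS]]].
  { intros n S; destruct (projection_exists (V S) (d n) (orth_closed _)) as [y [Vy O]].
    destruct (classic (y = vzero)) as [Z|N].
    - exists vzero; split; [apply csub_0, orth_closed|split; [left; reflexivity|]].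
      intros x Vx _; specialize (O x Vx); rewrite Z in O.
      apply inner_0_sym; rewrite <- O; f_equal; vring.
    - destruct (scale_to_unit y N) as [r [Pr [_ E]]].
      exists (vscal (RtoC (/ r)) y); split; [apply csub_scal; [apply orth_closed|exact Vy]|].
      split; [right; rewrite inner_self, E; reflexivity|].
      intros x Vx I; specialize (O x Vx); apply inner_0_sym in O.
      rewrite inner_sub_r in O; rewrite inner_scal_r in I.
      assert (Pi := Rinv_0_lt_compat _ Pr).
      apply (f_equal Cre) in O as O1; apply (f_equal Cim) in O as O2.
      apply (f_equal Cre) in I as I1; apply (f_equal Cim) in I as I2.
      simpl in O1, O2, I1, I2.
      apply Cx_ext; simpl; nra. }
  assert (VS : forall n x, V (S n) x <->
    (forall i, (i < n)%nat -> inner x (g i) = C0) /\ forall k, inner x (u k) = C0).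
  { intros n x; split.
    - intros X; split; [intros i Hi|intros k]; apply X; [left|right; exists k; reflexivity].
      apply (HS n); exists i; auto.
    - intros [X Y] y [Sy|[k ->]]; [|apply Y].
      apply (HS n y) in Sy; destruct Sy as [i [Hi ->]]; auto. }
  assert (GV := fun n => proj1 (VS n (g n)) (proj1 (G n))).
  exists g; split; [split|split].
  - intros i j N; destruct (Nat.lt_ge_cases i j).
    + apply inner_0_sym, (proj1 (GV j)); auto.
    + apply (proj1 (GV i)); lia.
  - intros i; apply G.
  - intros n; apply GV.
  - intros x Xu Xg.
    assert (XD : forall n, inner x (d n) = C0).
    { intros n; apply (proj2 (proj2 (G n))); [apply VS; auto|apply Xg]. }
    apply NNPP; intros N; assert (P : 0 < nsq x) by (apply inner_pos, N).
    (* If [x] is orthogonal to every [d n], then |x - d_n|^2 >= |x|^2, so no [d n] comes within |x|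
       of it. *)
    destruct (Hd x (sqrt (nsq x)) (sqrt_lt_R0 _ P)) as [n Hn].
    apply vnorm_lt in Hn; [|apply sqrt_lt_R0, P].
    rewrite sqrt_def, nsq_sub, XD in Hn by lra; simpl in Hn.
    pose proof (nsq_nonneg (d n)); lra.
Qed.

(** Both systems may be infinite, so joining them over a single [nat] requires alternation. *)
Definition interleave (u g : nat -> H) n : H :=
  if Nat.even n then u (Nat.div2 n) else g (Nat.div2 n).

Lemma interleave_even u g n : interleave u g (2 * n) = u n.
Proof.
  unfold interleave; rewrite Nat.even_mul, Nat.div2_double; reflexivity.
Qed.

Lemma interleave_odd u g n : interleave u g (Datatypes.S (2 * n)) = g n.
Proof.
  unfold interleave; rewrite Nat.even_succ, Nat.odd_mul, Nat.div2_succ_double; reflexivity.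
Qed.

Lemma even_odd_cases n : exists k, n = (2 * k)%nat \/ n = Datatypes.S (2 * k).
Proof.
  exists (Nat.div2 n); destruct (Nat.Even_or_Odd n) as [E|O].
  - left; apply Nat.Even_double in E; unfold Nat.double in E; lia.
  - right; apply Nat.Odd_double in O; unfold Nat.double in O; lia.
Qed.

Lemma interleave_orthosys u g : orthosys u -> orthosys g ->
  (forall n k, inner (g n) (u k) = C0) -> orthosys (interleave u g).
Proof.
  intros Ou Og X; split.
  - intros i j N; destruct (even_odd_cases i) as [a [-> | ->]];
      destruct (even_odd_cases j) as [b [-> | ->]];
      rewrite ?interleave_even, ?interleave_odd.
    + apply (proj1 Ou); lia.
    + apply inner_0_sym, X.
    + apply X.
    + apply (proj1 Og); lia.
  - intros i; destruct (even_odd_cases i) as [a [-> | ->]];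
      rewrite ?interleave_even, ?interleave_odd; [apply Ou|apply Og].
Qed.

Definition nonzerob (e : nat -> H) n : bool :=
  if excluded_middle_informative (e n = vzero) then false else true.

Lemma orthosys_total_basis e : orthosys e -> total e -> orthonormal_basis (nonzerob e) e.
Proof.
  unfold nonzerob; intros O W; split.
  - intros n m Dn _; destruct (Nat.eqb_spec n m) as [<-|N]; [|apply (proj1 O), N].
    destruct (excluded_middle_informative (e n = vzero)); [discriminate|].
    destruct (proj2 O n); [contradiction|assumption].
  - intros x X; apply W; intros n; specialize (X n).
    destruct (excluded_middle_informative (e n = vzero)) as [E|_]; [|auto].
    rewrite E; apply inner_0_r.
Qed.

Lemma svd_vnorm_image u s n : svd T u s -> vnorm (T (u n)) = s n.
Proof.
  intros D; pose proof (svd_nonneg _ _ _ D n) as P.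
  unfold vnorm; rewrite (svd_eigen _ _ _ D).
  replace (Cre (Cmul (RtoC (s n * s n)) (inner (u n) (u n)))) with (s n * s n);
    [apply sqrt_square, P|].
  destruct P as [P|Z].
  - rewrite (svd_unit T u s n D P); simpl; ring.
  - rewrite <- Z; simpl; ring.
Qed.

(** The [u k] occupy the even positions and [T] kills the odd ones, so the first n terms contain n /
    2 singular values, rounded up. A position dropped because its vector is zero had contributed
    0. *)
Lemma svd_basis u s p : @separable H -> linear_op T -> svd T u s ->
  exists (D : nat -> bool) (e : nat -> H), orthonormal_basis D e /\
    forall n, rsum n (fun n => if D n then rpow (vnorm (T (e n))) p else 0) =
      rsum (Nat.div2 (Datatypes.S n)) (fun k => rpow (s k) p).
Proof.
  intros SP L D; destruct (orthosys_complement u SP) as [g [Og [Ogu W]]].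
  pose proof (svd_orthosys _ _ _ D) as Ou.
  set (e := interleave u g).
  exists (nonzerob e), e; split.
  - apply orthosys_total_basis; [apply interleave_orthosys; auto|].
    intros x X; apply W; intros n.
    + rewrite <- (interleave_even u g n); apply X.
    + rewrite <- (interleave_odd u g n); apply X.
  - intros n; rewrite (rsum_ext _ _ (fun n => rpow (vnorm (T (e n))) p)).
    2:{ intros i _; unfold nonzerob.
        destruct (excluded_middle_informative (e i = vzero)) as [E|_]; [|reflexivity].
        rewrite E, linear_0, vnorm_zero, rpow_0 by exact L; reflexivity. }
    assert (EV : forall k, rsum (2 * k) (fun n => rpow (vnorm (T (e n))) p)
                   = rsum k (fun k => rpow (s k) p)).
    { induction k as [|k IH]; [reflexivity|].
      replace (2 * Datatypes.S k)%nat with (Datatypes.S (Datatypes.S (2 * k))) by lia.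
      cbn [rsum]; rewrite IH; unfold e; rewrite interleave_even, interleave_odd.
      rewrite (svd_kernel _ _ _ D (g k)) by auto.
      rewrite vnorm_zero, rpow_0, (svd_vnorm_image u s k D); ring. }
    destruct (even_odd_cases n) as [k [-> | ->]].
    + rewrite EV, Nat.div2_succ_double; reflexivity.
    + replace (Datatypes.S (Datatypes.S (2 * k))) with (2 * Datatypes.S k)%nat by lia.
      rewrite Nat.div2_double; cbn [rsum]; rewrite EV; unfold e.
      rewrite interleave_even, (svd_vnorm_image u s k D); reflexivity.
Qed.

End Frames.

(** The implications run in a cycle: (a) to (c) by the power-sum bound, (c) to (b) by extending a
    basis with zeros, (b) to (a) by testing the basis adapted to the decomposition. That basis and
    its extension attain the two suprema. *)
Theorem theorem2 (H : Hilbert) (T : H -> H) (p : R) :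
  @separable H -> compact_op T -> 2 <= p ->
  (* (a) <-> (b) *)
  (in_Sp T p <->
     (forall (D : nat -> bool) (e : nat -> H), orthonormal_basis D e ->
        exists l, infinite_sum
          (fun n => if D n then rpow (vnorm (T (e n))) p else 0) l)) /\
  (* (a) <-> (c) *)
  (in_Sp T p <->
     (forall f : nat -> H, frame f ->
        exists l, infinite_sum (fun n => rpow (vnorm (T (f n))) p) l)) /\
  (* Moreover: ||T||_p^p = sup over ONBs = sup over frames with upper bound <= 1 *)
  (in_Sp T p ->
     exists v, Sp_pnorm_pow T p v /\
       is_lub (fun t => exists (D : nat -> bool) (e : nat -> H),
                 orthonormal_basis D e /\
                 infinite_sum (fun n => if D n then rpow (vnorm (T (e n))) p else 0) t) v /\
       is_lub (fun t => exists f : nat -> H,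
                 frame f /\ (exists B, upper_frame_bound f B /\ B <= 1) /\
                 infinite_sum (fun n => rpow (vnorm (T (f n))) p) t) v).
Proof.
  intros SP C P2; pose proof (proj1 C) as L.
  destruct (svd_exists T C) as [u [s D]].
  assert (SV := svd_singular_values T u s C D).
  assert (POS : forall f : nat -> H, forall n, 0 <= rpow (vnorm (T (f n))) p)
    by (intros; apply rpow_nonneg).
  (* The sequence provided by [in_Sp] is replaced by the one of the decomposition. *)
  assert (SUM : in_Sp T p -> exists v, infinite_sum (fun n => rpow (s n) p) v).
  { intros [_ [s' [S' [v V]]]]; exists v; eapply infinite_sum_ext; [|exact V].
    intros n; simpl; rewrite (singular_values_unique T s s' SV S'); reflexivity. }
  assert (BD : forall v f c, infinite_sum (fun n => rpow (s n) p) v -> 0 < c ->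
    bessel_seq f c -> forall N, rsum N (fun n => rpow (vnorm (T (f n))) p) <= rpow c (p / 2) * v).
  { intros v f c V Pc B; apply (svd_bessel_power_sum T u s); auto.
    intros K; apply rsum_le_infinite_sum; [intros; apply rpow_nonneg|exact V]. }
  assert (AC : in_Sp T p -> forall f : nat -> H, frame f ->
    exists l, infinite_sum (fun n => rpow (vnorm (T (f n))) p) l).
  { intros A f [c1 [c2 F]]; destruct (SUM A) as [v V].
    destruct (bounded_rsum_summable (fun n => rpow (vnorm (T (f n))) p) (rpow c2 (p / 2) * v))
      as [l [Hl _]]; [apply POS| |exists l; exact Hl].
    apply BD; [exact V|destruct F; lra|apply frame_bounds_bessel with c1, F]. }
  assert (CB : (forall f : nat -> H, frame f ->
      exists l, infinite_sum (fun n => rpow (vnorm (T (f n))) p) l) ->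
    forall (D : nat -> bool) (e : nat -> H), orthonormal_basis D e ->
      exists l, infinite_sum (fun n => if D n then rpow (vnorm (T (e n))) p else 0) l).
  { intros F D' e' O'; destruct (F (extend_by_zero D' e')) as [l Hl].
    { exists 1, 1; apply orthonormal_basis_parseval, O'. }
    exists l; eapply infinite_sum_ext; [|exact Hl].
    intros n; apply rpow_extend_by_zero, L. }
  destruct (svd_basis T u s p SP L D) as [D0 [e0 [O0 E0]]].
  assert (BA : (forall (D : nat -> bool) (e : nat -> H), orthonormal_basis D e ->
      exists l, infinite_sum (fun n => if D n then rpow (vnorm (T (e n))) p else 0) l) ->
    in_Sp T p).
  { intros B; split; [exact C|]; exists s; split; [exact SV|].
    destruct (B D0 e0 O0) as [l Hl].
    destruct (bounded_rsum_summable (fun n => rpow (s n) p) l) as [v [V _]];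
      [intros; apply rpow_nonneg| |exists v; exact V].
    intros n; apply Rle_trans with
      (rsum (2 * n) (fun n => if D0 n then rpow (vnorm (T (e0 n))) p else 0)).
    - rewrite E0, Nat.div2_succ_double; lra.
    - apply rsum_le_infinite_sum; [|exact Hl].
      intros i; destruct (D0 i); [apply rpow_nonneg|lra]. }
  split; [split; auto|split; [split; auto|]].
  intros A; destruct (SUM A) as [v V]; exists v.
  assert (ONE : rpow 1 (p / 2) = 1).
  { rewrite rpow_pos by lra; unfold Rpower; rewrite ln_1, Rmult_0_r; apply exp_0. }
  assert (LE : forall f t, bessel_seq f 1 ->
    infinite_sum (fun n => rpow (vnorm (T (f n))) p) t -> t <= v).
  { intros f t B S; apply infinite_sum_rsum in S; apply (Un_cv_le_const _ _ _ S).
    intros n; eapply Rle_trans; [apply (BD v f 1); auto; lra|rewrite ONE; lra]. }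
  assert (S0 : infinite_sum (fun n => if D0 n then rpow (vnorm (T (e0 n))) p else 0) v).
  { apply infinite_sum_rsum; apply infinite_sum_rsum in V.
    intros e He; destruct (V e He) as [N HN]; exists (2 * N)%nat; intros n Hn.
    rewrite E0; apply HN.
    destruct (even_odd_cases n) as [k [-> | ->]].
    - rewrite Nat.div2_succ_double; lia.
    - replace (Datatypes.S (Datatypes.S (2 * k))) with (2 * Datatypes.S k)%nat by lia.
      rewrite Nat.div2_double; lia. }
  split; [exists s; auto|split; split].
  - intros t [D' [e' [O' S']]]; apply (LE (extend_by_zero D' e')).
    + apply frame_bounds_bessel with 1, orthonormal_basis_parseval, O'.
    + eapply infinite_sum_ext; [|exact S'].
      intros n; simpl; rewrite rpow_extend_by_zero by exact L; reflexivity.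
  - intros b Hb; apply Hb; exists D0, e0; auto.
  - intros t [f [F [[B [U LB]] S]]]; apply (LE f); [|exact S].
    apply upper_frame_bound_bessel with B; auto.
  - intros b Hb; apply Hb; exists (extend_by_zero D0 e0).
    assert (F := orthonormal_basis_parseval D0 e0 O0).
    split; [exists 1, 1; exact F|split; [apply parseval_upper_frame_bound, F|]].
    eapply infinite_sum_ext; [|exact S0].
    intros n; simpl; rewrite rpow_extend_by_zero by exact L; reflexivity.
Qed.
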